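(* Let $X$ be a wedge of $n$ circles with $n=\operatorname{rank}(\pi_1(X))\geq 3$, and let $f:Y\to X$ be a finite normal (regular) cover with $Y$ connected and deck group $G$. Then for every $0\neq v\in H_1(Y;\mathbb{Q})$ the $\Gamma_G$-orbit of $v$ in $H_1(Y;\mathbb{Q})$ is infinite. In fact, given any $0\neq v\in H_1(Y;\mathbb{Q})$, there exists a homotopy equivalence $F:X\to X$ such that $F$ lifts to a map $\widetilde{F}:Y\to Y$ (that is, $f\circ\widetilde{F}=F\circ f$) and such that the set $\{\widetilde{F}^d(v): d\in\mathbb{Z}\}\subseteq H_1(Y;\mathbb{Q})$ is infinite.
   Context: The group $\operatorname{Out}(F_n)$ of outer automorphisms of the free group $F_n=\pi_1(X)$ is identified with the group of homotopy classes of homotopy equivalences of the wedge $X$ of $n$ circles. For a finite regular cover $f:Y\to X$ with deck group $G=\pi_1(X)/\pi_1(Y)$, $\Gamma_G<\operatorname{Out}(F_n)$ denotes the finite-index subgroup of those homotopy equivalences which lift to $Y$ and act trivially on $G$ (i.e. the classes represented by automorphisms of $F_n$ that preserve the normal subgroup $\pi_1(Y)$ and induce the identity on $G$). The group $\Gamma_G$ acts on $H_1(Y;\mathbb{Q})$ through the maps induced on homology by lifts to $Y$; a lift is only determined up to composition with elements of the finite deck group $G$, which does not affect whether an orbit is infinite. The $\Gamma_G$-orbit of $v$ is the set of all images of $v$ under these induced maps. In the second assertion, $\widetilde{F}^d(v)$ means $(\widetilde{F}_* )^d(v)$, where $\widetilde{F}_*\in \mathrm{GL}(H_1(Y;\mathbb{Q}))$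 is the (invertible) map induced by $\widetilde{F}$. *)

(* Defs.v *)
From HB Require Import structures.
From mathcomp Require Import all_boot all_order all_algebra generic_quotient.
From mathcomp Require Import ring_quotient.
From mathcomp Require Import all_classical all_reals topology normedtype.
From mathcomp Require Import homotopy.
From mathcomp Require Import freeg.

Set Implicit Arguments.
Unset Strict Implicit.
Unset Printing Implicit Defensive.

Import Order.TTheory GRing.Theory Num.Theory.
Import numFieldNormedType.Exports.

Local Open Scope classical_set_scope.
Local Open Scope ring_scope.
Local Open Scope quotient_scope.

Section Rose.
Context (R : realType).

Definition unit_circle : set (R * R) := [set p | p.1 ^+ 2 + p.2 ^+ 2 = 1].

Lemma circle_base_subproof : ((1, 0) : R * R) \in unit_circle.
Proof. by rewrite inE /unit_circle /= expr1n expr0n addr0. Qed.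

Definition circle_base : unit_circle := exist _ (1, 0) circle_base_subproof.

Definition rose (n : nat) : topologicalType :=
  wedge (fun _ : 'I_n => circle_base).

End Rose.

Lemma fglift_linear (K : choiceType) (M : lmodType rat) (h : K -> M) :
  linear (fglift h : {freeg K / rat} -> M).
Proof.
have subl := lift_is_additive h.
have l0 : fglift h 0 = 0 by have := subl 0 0; rewrite !subrr.
have lN z : fglift h (- z) = - fglift h z by rewrite -sub0r subl l0 sub0r.
have addl (x y : {freeg K / rat}) : fglift h (x + y) = fglift h x + fglift h y.
  by rewrite -{1}[y]opprK subl lN opprK.
have scaleU (c k : rat) (x : K) :
    c *: << k *g x >> = << c * k *g x >> :> {freeg K / rat}.
  by apply/eqP/freeg_eqP => y; rewrite coeffZ !coeffU mulrA.
move=> c x y; rewrite addl; congr (_ + _).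
elim/freeg_ind_dom0: x => [|k z D _ _ IH].
  by rewrite scaler0 l0 scaler0.
by rewrite scalerDr !addl IH scalerDr scaleU !liftU scalerA.
Qed.

Section SingularHomology.
Context (R : realType).

Definition std_simplex (k : nat) : set 'rV[R]_k.+1 :=
  [set t | (forall j, 0 <= t 0 j) /\ \sum_j t 0 j = 1].
Arguments std_simplex : clear implicits.

(* The i-th coface in barycentric coordinates: t is sent to the vector whose
   i-th coordinate is 0 and whose other coordinates are those of t, in order. *)
Definition insert0 k (i : 'I_k.+2) (t : 'rV[R]_k.+1) : 'rV[R]_k.+2 :=
  \row_j (if unlift i j is Some j' then t 0 j' else 0).

Lemma insert0_subproof k (i : 'I_k.+2) (t : std_simplex k) :
  insert0 i (\val t) \in std_simplex k.+1.
Proof.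
case: t => t /=; rewrite !inE => -[t0 t1]; split=> [j|].
  by rewrite mxE; case: unlift.
rewrite (bigD1_ord i) //= mxE unlift_none add0r -[RHS]t1.
by apply: eq_bigr => j _; rewrite mxE liftK.
Qed.

Definition face k (i : 'I_k.+2) (t : std_simplex k) : std_simplex k.+1 :=
  exist _ (insert0 i (\val t)) (insert0_subproof i t).

Lemma face_continuous k (i : 'I_k.+2) : continuous (@face k i).
Proof.
apply: continuous_comp_initial => t.
have cval : {for t, continuous (\val : std_simplex k -> 'rV[R]_k.+1)}.
  exact: initial_continuous.
apply: (@continuous_comp _ _ _ _ (insert0 i)) cval _ => A [P] nP PA.
case: (t) nP => {}t tS /= nP.
pose Q (a : 'I_1) (j : 'I_k.+1) := P a (fintype.lift i j).
exists Q => [a j|u Qu].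
  have := nP a (fintype.lift i j); rewrite mxE liftK.
  by rewrite (ord1 a).
apply: PA => a j; have := nP a j; rewrite !mxE ord1 => nj.
case: (unliftP i j) nj => [j' ->|-> ] nj; rewrite ?liftK ?unlift_none.
  by rewrite -(ord1 a); exact: Qu.
exact: nbhs_singleton nj.
Qed.

HB.instance Definition _ k (i : 'I_k.+2) :=
  @isContinuous.Build _ _ (@face k i) (@face_continuous k i).

Definition singular_simplex (k : nat) (X : topologicalType) :=
  continuousType (std_simplex k) X.

HB.instance Definition _ k X := Choice.on (singular_simplex k X).

Definition chain (k : nat) (X : topologicalType) : lmodType rat :=
  {freeg (singular_simplex k X) / rat}.

Definition simplex_boundary k (X : topologicalType)
    (s : singular_simplex k.+1 X) : chain k X :=
  \sum_(i < k.+2) (-1) ^+ i *: << (s \o @face k i : singular_simplex k X) >>.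

Definition boundary k (X : topologicalType) : chain k.+1 X -> chain k X :=
  fglift (@simplex_boundary k X).

Definition chain_map k (X Y : topologicalType) (g : continuousType X Y) :
    chain k X -> chain k Y :=
  fglift (fun s : singular_simplex k X =>
    << (g \o s : singular_simplex k Y) >> : chain k Y).

Lemma boundary_linear k X : linear (@boundary k X).
Proof. exact: fglift_linear. Qed.

HB.instance Definition _ k X := GRing.isLinear.Build rat (chain k.+1 X)
  (chain k X) _ (@boundary k X) (@boundary_linear k X).

Lemma chain_map_linear k (X Y : topologicalType) (g : continuousType X Y) :
  linear (@chain_map k X Y g).
Proof. exact: fglift_linear. Qed.

HB.instance Definition _ k (X Y : topologicalType) (g : continuousType X Y) :=
  GRing.isLinear.Build rat (chain k X) (chain k Y) _ (@chain_map k X Y g) (@chain_map_linear k X Y g).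

Lemma boundary_chain_map k (X Y : topologicalType)
  (g : continuousType X Y) (c : chain k.+1 X) :
  boundary (chain_map g c) = chain_map g (boundary c).
Proof.
elim/freeg_ind_dom0: c => [|q s D _ _ IH]; first by rewrite !linear0.
rewrite !linearD /= IH; congr (_ + _).
have boundaryU Z p (t : singular_simplex _ Z) :
  boundary << p *g t >> = p *: simplex_boundary t by exact: liftU.
have chain_mapU l p (t : singular_simplex l X) : chain_map g << p *g t >>
  = p *: << (g \o t : singular_simplex l Y) >> by exact: liftU.
rewrite chain_mapU boundaryU !linearZ /= boundaryU scale1r; congr (_ *: _).
rewrite /simplex_boundary linear_sum; apply: eq_bigr => i _ /=.
rewrite [RHS]linearZ /= chain_mapU scale1r; congr (_ *: _).
congr (<< _ >>); exact/continuousEP.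
Qed.

Definition is_cycle1 X (c : chain 1 X) : bool := boundary c == 0.

Lemma is_cycle1_submod X : submod_closed (@is_cycle1 X).
Proof.
split=> [|q z1 z2]; rewrite /is_cycle1 -!topredE /= ?linear0 //.
move=> /eqP h1 /eqP h2.
by rewrite linearP /= h1 h2 scaler0 addr0.
Qed.

HB.instance Definition _ X := GRing.isSubmodClosed.Build rat (chain 1 X)
  (@is_cycle1 X) (@is_cycle1_submod X).

Record cycle1 (X : topologicalType) :=
  Cycle1 { chain_of_cycle1 :> chain 1 X; _ : is_cycle1 chain_of_cycle1 }.

HB.instance Definition _ X := [isSub for @chain_of_cycle1 X].
HB.instance Definition _ X := [Choice of cycle1 X by <:].
HB.instance Definition _ X := [SubChoice_isSubLmodule of cycle1 X by <:].

(* H1 is the space of 1-cycles modulo the image of the boundary from degree 2. *)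
Definition is_boundary1 X (z : cycle1 X) : bool :=
  `[< exists w : chain 2 X, boundary w = z >].

Lemma is_boundary1_submod X : submod_closed (@is_boundary1 X).
Proof.
split=> [|q z1 z2]; first by apply/asboolP; exists 0; rewrite linear0.
move=> /asboolP[w1 h1] /asboolP[w2 h2]; apply/asboolP.
by exists (q *: w1 + w2); rewrite linearP /= h1 h2.
Qed.

HB.instance Definition _ X := GRing.isSubmodClosed.Build rat (cycle1 X)
  (@is_boundary1 X) (@is_boundary1_submod X).

Definition H1 (X : topologicalType) :=
  Quotient.quot (GRing.ZmodClosed.clone _ (@is_boundary1 X) _).

HB.instance Definition _ X := Quotient.on (H1 X).
HB.instance Definition _ X := GRing.Zmodule.on (H1 X).

Lemma H1_eqP X (z1 z2 : cycle1 X) :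
  \pi_(H1 X) z1 = \pi_(H1 X) z2 <->
  exists w : chain 2 X, boundary w = val z1 - val z2.
Proof.
split=> [/eqP|[w bw]]; last apply/eqP.
  by rewrite -Quotient.idealrBE => /asboolP.
by rewrite -Quotient.idealrBE; apply/asboolP; exists w.
Qed.

Lemma H1_piD X (z1 z2 : cycle1 X) :
  \pi_(H1 X) (z1 + z2) = \pi_(H1 X) z1 + \pi_(H1 X) z2.
Proof. by rewrite [RHS]piE. Qed.

Definition H1_scale X (q : rat) (v : H1 X) : H1 X := \pi_(H1 X) (q *: repr v).

Lemma H1_pi_scale X q (z : cycle1 X) :
  \pi_(H1 X) (q *: z) = H1_scale q (\pi_(H1 X) z).
Proof.
have /H1_eqP[w bw] : \pi_(H1 X) z = \pi_(H1 X) (repr (\pi_(H1 X) z))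
  by rewrite reprK.
by apply/H1_eqP; exists (q *: w); rewrite linearZ /= bw scalerBr.
Qed.

Lemma H1_scaleA X a b (v : H1 X) :
  H1_scale a (H1_scale b v) = H1_scale (a * b) v.
Proof.
by elim/quotW: v => z; rewrite -(H1_pi_scale b z) -!H1_pi_scale scalerA.
Qed.

Lemma H1_scale1 X : left_id 1 (@H1_scale X).
Proof. by elim/quotW=> z; rewrite -H1_pi_scale scale1r. Qed.

Lemma H1_scaleDr X : right_distributive (@H1_scale X) +%R.
Proof.
move=> q; elim/quotW=> u; elim/quotW=> v; rewrite -!H1_pi_scale.
rewrite -!H1_piD -H1_pi_scale.
by rewrite scalerDr.
Qed.

Lemma H1_scaleDl X (v : H1 X) : {morph (@H1_scale X)^~ v : a b / a + b}.
Proof. by elim/quotW: v => z a b; rewrite -!H1_pi_scale -H1_piD scalerDl. Qed.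

HB.instance Definition _ X := GRing.Zmodule_isLmodule.Build rat (H1 X)
  (@H1_scaleA X) (@H1_scale1 X) (@H1_scaleDr X) (@H1_scaleDl X).

Lemma H1_piZ X q (z : cycle1 X) :
  \pi_(H1 X) (q *: z) = q *: \pi_(H1 X) z.
Proof. exact: H1_pi_scale. Qed.

Lemma cycle1_map_subproof (X Y : topologicalType) (g : continuousType X Y)
  (z : cycle1 X) : is_cycle1 (chain_map g z).
Proof.
by case: z => z /= /eqP bz; rewrite /is_cycle1 /= boundary_chain_map bz linear0.
Qed.

Definition cycle1_map (X Y : topologicalType) (g : continuousType X Y)
  (z : cycle1 X) : cycle1 Y := Cycle1 (cycle1_map_subproof g z).

Definition H1_map (X Y : topologicalType) (g : continuousType X Y) :
  H1 X -> H1 Y := fun v => \pi_(H1 Y) (cycle1_map g (repr v)).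

Lemma H1_map_pi (X Y : topologicalType) (g : continuousType X Y)
  (z : cycle1 X) : H1_map g (\pi_(H1 X) z) = \pi_(H1 Y) (cycle1_map g z).
Proof.
have /H1_eqP[w bw] : \pi_(H1 X) (repr (\pi_(H1 X) z)) = \pi_(H1 X) z
  by rewrite reprK.
apply/H1_eqP; exists (chain_map g w).
by rewrite boundary_chain_map bw linearB.
Qed.

Lemma H1_map_linear (X Y : topologicalType) (g : continuousType X Y) :
  linear (H1_map g).
Proof.
move=> q; elim/quotW=> u; elim/quotW=> v.
rewrite -H1_piZ -H1_piD !H1_map_pi -H1_piZ -H1_piD.
by congr (\pi_(H1 Y) _); apply: val_inj; rewrite /= linearP.
Qed.

HB.instance Definition _ (X Y : topologicalType) (g : continuousType X Y) :=
  GRing.isLinear.Build rat (H1 X) (H1 Y) _ (H1_map g) (H1_map_linear g).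

End SingularHomology.

Section Covers.
Context (E B : topologicalType).
Implicit Types (f : E -> B) (F : continuousType B B) (Ft g : continuousType E E).

(* The preimage of U is a disjoint union of open sheets S i, each of which f
   maps homeomorphically onto U, with inverse the section s. *)
Definition evenly_covered f (U : set B) : Prop :=
  exists (I : Type) (S : I -> set E),
    [/\ forall i, open (S i),
        trivIset [set: I] S,
        \bigcup_i S i = f @^-1` U
      & forall i, exists s : B -> E,
        [/\ {within U, continuous s},
            forall x, U x -> S i (s x) /\ f (s x) = x
          & forall y, S i y -> s (f y) = y]].

Definition covering_map f : Prop :=
  [/\ continuous f, set_surj [set: E] [set: B] f
    & forall x, exists U, [/\ open U, U x & evenly_covered f U]].

(* The deck transformations: self-homeomorphisms of E over B. *)
Definition deck f g : Prop :=
  f \o g = f /\ exists h : continuousType E E, cancel g h /\ cancel h g.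

(* Regularity (normality) of a connected cover is transitivity of the deck
   group on every fibre. *)
Definition finite_regular_cover f : Prop :=
  [/\ covering_map f, connected [set: E],
      forall x, finite_set (f @^-1` [set x])
    & forall y y', f y = f y' -> exists2 g, deck f g & g y = y'].

Definition lift_of f F Ft : Prop := f \o Ft = F \o f.

End Covers.

Section HomotopyEquivalences.
Context (R : realType).

Definition homotopic (X Y : topologicalType) (f g : X -> Y) : Prop :=
  exists h : X * R -> Y,
    [/\ {within [set: X] `*` `[0, 1], continuous h},
        forall x, h (x, 0) = f x & forall x, h (x, 1) = g x].

Definition homotopy_equivalence (X Y : topologicalType)
    (f : continuousType X Y) : Prop :=
  exists g : continuousType Y X,
    homotopic (g \o f) idfun /\ homotopic (f \o g) idfun.

End HomotopyEquivalences.

Section GammaG.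
Context (R : realType) (E B : topologicalType).
Implicit Types (f : E -> B) (F : continuousType B B) (Ft g : continuousType E E).

(* A lift Ft of a homotopy equivalence acts on the deck group G by the
   automorphism phi determined by Ft \o g = phi g \o Ft, which corresponds to
   the map induced on pi_1(B) / pi_1(E); here phi is the identity. Another lift
   changes phi by an inner automorphism of G, so for the outer class of F one
   asks for some lift with phi = id. *)
Definition trivial_on_deck f Ft : Prop :=
  forall g, deck f g -> Ft \o g = g \o Ft.

Definition Gamma f F : Prop :=
  homotopy_equivalence R F /\
  exists2 Ft, lift_of f F Ft & trivial_on_deck f Ft.

(* All lifts are used, not only those that act trivially on the deck group. *)
Definition Gamma_orbit f (v : H1 R E) : set (H1 R E) :=
  [set H1_map Ft v | Ft in [set Ft | exists2 F, Gamma f F & lift_of f F Ft]].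

End GammaG.

(* The d-th power of phi, for d an integer and psi the inverse of phi. *)
Definition ziter (T : Type) (phi psi : T -> T) (d : int) : T -> T :=
  match d with
  | Posz m => iter m phi
  | Negz m => iter m.+1 psi
  end.

(* Main.v *)
From HB Require Import structures.
Require Import Defs.
From mathcomp Require Import all_boot all_order all_algebra ring_quotient.
From mathcomp Require Import fingroup perm finmap.
From mathcomp Require Import all_classical all_reals topology normedtype trigo.
From mathcomp Require Import homotopy freeg lra ring.

Set Implicit Arguments.
Unset Strict Implicit.
Unset Printing Implicit Defensive.

Import Order.TTheory GRing.Theory Num.Theory.
Import numFieldNormedType.Exports.

Local Open Scope classical_set_scope.
Local Open Scope ring_scope.

(** Let T be the fibre of the cover Y over the base point of the rose. From every
    u in T starts, for every circle j of the rose, one lift (u, j) of that circle,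
    and it ends at sig j u for a permutation sig j of T. So Y is a finite graph,
    and its first homology is identified with the rational cycles k on the set of
    these edges ([cycle_homologous], [gchain_inj]).

    Fix a letter i and a word w in the other letters whose permutation of T is
    trivial. The automorphism of the free group that maps the generator x_i to
    x_i w and fixes all other generators is induced by a homotopy equivalence of
    the rose. It lifts to the map of Y that fixes the edges (u, j) with j <> i and
    prolongs (u, i) by the loop spelled by w at its end; this lift commutes with
    all deck transformations ([transvection_natural]). On homology it is 1 + N,
    where N k is the sum over u of k(u, i) times the class of the loop spelled by
    w at sig i u ([transvection_homologous]). As w avoids i, N N = 0, and the d-th
    iterate maps v to v + d N v. The word w^d has the effect 1 + d N, so that the
    same vectors lie in the orbit of v. Hence all that is needed is a choice of i
    and w with N v <> 0.

    Take i such that some coefficient of v at an edge (u, i) is nonzero, and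
    suppose that N v = 0 for all w. As the rank is at least three there are two
    further letters y and z. If w runs through all words without i, the sums of
    the classes of its paths, weighted by the coefficients of v, only depend on
    the permutation of w; this is a crossed homomorphism on a finite group, and
    averaging over the group produces primitives for the directions y and z.
    These satisfy incompatible identities unless the coefficients vanish
    ([killed0]). The argument takes the place of the theorem of Gaschuetz, by
    which the homology of a cover of a rose with at least two circles contains
    the regular representation of the deck group.

    The comparison of singular and combinatorial homology uses cocycles. A cocycle
    that vanishes on the edges is a coboundary ([path_exact]), because short paths
    can be moved into a single edge by maps of Y that are homotopic to the
    identity and preserve all edges. For each edge there is a cocycle that counts
    the signed passages of a path over the end of that edge ([edge_cocycle]); it
    is the integral of a function of pairs of points that is additive on small
    sets. *)

(** * Continuity of explicit real functions, and gluing *)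

Section Continuity.
Context (R : realType).

Lemma cont_comp (S T U : topologicalType) (f : S -> T) (g : T -> U) :
  continuous f -> continuous g -> continuous (fun x => g (f x)).
Proof. by move=> cf cg x; apply: continuous_comp; [exact: cf|exact: cg]. Qed.

Lemma cont_cst (S T : topologicalType) (y : T) : continuous (fun _ : S => y).
Proof. by move=> x; exact: cvg_cst. Qed.

Lemma cont_id (S : topologicalType) : continuous (fun x : S => x).
Proof. by move=> x; exact: cvg_id. Qed.

Lemma cont_pair (S T U : topologicalType) (f : S -> T) (g : S -> U) :
  continuous f -> continuous g -> continuous (fun x => (f x, g x)).
Proof. by move=> cf cg x; apply: cvg_pair; [exact: cf|exact: cg]. Qed.

Lemma cont_fst (S T U : topologicalType) (f : S -> T * U) :
  continuous f -> continuous (fun x => (f x).1).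
Proof. by move=> cf; apply: cont_comp cf _ => x; exact: cvg_fst. Qed.

Lemma cont_snd (S T U : topologicalType) (f : S -> T * U) :
  continuous f -> continuous (fun x => (f x).2).
Proof. by move=> cf; apply: cont_comp cf _ => x; exact: cvg_snd. Qed.

Lemma cont_add (S : topologicalType) (f g : S -> R) :
  continuous f -> continuous g -> continuous (fun x => f x + g x).
Proof. by move=> cf cg x; apply: cvgD; [exact: cf|exact: cg]. Qed.

Lemma cont_opp (S : topologicalType) (f : S -> R) :
  continuous f -> continuous (fun x => - f x).
Proof. by move=> cf x; apply: cvgN; exact: cf. Qed.

Lemma cont_mul (S : topologicalType) (f g : S -> R) :
  continuous f -> continuous g -> continuous (fun x => f x * g x).
Proof. by move=> cf cg x; apply: cvgM; [exact: cf|exact: cg]. Qed.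

Lemma cont_min (S : topologicalType) (f g : S -> R) :
  continuous f -> continuous g -> continuous (fun x => Num.min (f x) (g x)).
Proof. exact: min_fun_continuous. Qed.

Lemma cont_max (S : topologicalType) (f g : S -> R) :
  continuous f -> continuous g -> continuous (fun x => Num.max (f x) (g x)).
Proof. exact: max_fun_continuous. Qed.

End Continuity.

Ltac rcont :=
  lazymatch goal with
  | |- continuous ?f =>
    lazymatch f with
    | (fun x => @GRing.add _ (@?a x) (@?b x)) =>
        refine (@cont_add _ _ a b _ _); rcont
    | (fun x => @GRing.mul _ (@?a x) (@?b x)) =>
        refine (@cont_mul _ _ a b _ _); rcont
    | (fun x => @GRing.opp _ (@?a x)) => refine (@cont_opp _ _ a _); rcont
    | (fun x => Num.min (@?a x) (@?b x)) =>
        refine (@cont_min _ _ a b _ _); rcont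
    | (fun x => Num.max (@?a x) (@?b x)) =>
        refine (@cont_max _ _ a b _ _); rcont
    | (fun x => (@?a x, @?b x)) =>
        refine (@cont_pair _ _ _ a b _ _); rcont
    | (fun x => (@?a x).1) => refine (@cont_fst _ _ _ a _); rcont
    | (fun x => (@?a x).2) => refine (@cont_snd _ _ _ a _); rcont
    | (fun x => x) => exact (@cont_id _)
    | @GRing.mul _ ?a =>
        refine (@cont_mul _ _ (fun=> a) id _ _); rcont
    | @GRing.add _ ?a =>
        refine (@cont_add _ _ (fun=> a) id _ _); rcont
    | @pair _ _ ?a =>
        refine (@cont_pair _ _ _ (fun=> a) id _ _); rcont
    | id => exact (@cont_id _)
    | @fst _ _ => exact (cont_fst (@cont_id _))
    | @snd _ _ => exact (cont_snd (@cont_id _))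
    | _ => first [assumption | exact: cts_fun | exact: cont_cst | idtac]
    end
  end.

Section Basic.
Context (R : realType).

(** Only the values on [0, 1] of a path matter; precomposing with [clamp] lets
    every path be a function that is continuous on the whole line. *)
Definition clamp (t : R) : R := Num.max 0 (Num.min 1 t).

Lemma clamp_cont : continuous clamp.
Proof. by rewrite /clamp; rcont. Qed.

Lemma clamp01 t : 0 <= clamp t <= 1.
Proof. by rewrite /clamp le_max lexx /= ge_max ler01 ge_min lexx. Qed.

Lemma clampK t : 0 <= t <= 1 -> clamp t = t.
Proof. by case/andP => t0 t1; rewrite /clamp (min_idPr t1) (max_idPr t0). Qed.

Lemma in01_0 : 0 <= (0 : R) <= 1. Proof. by rewrite lexx ler01. Qed.
Lemma in01_1 : 0 <= (1 : R) <= 1. Proof. by rewrite lexx ler01. Qed.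

Lemma clamp0 : clamp 0 = 0. Proof. by rewrite clampK// lexx ler01. Qed.
Lemma clamp1 : clamp 1 = 1. Proof. by rewrite clampK// lexx ler01. Qed.

Lemma hausdorff_pair (S T : topologicalType) :
  hausdorff_space S -> hausdorff_space T -> hausdorff_space (S * T)%type.
Proof.
move=> hS hT [a b] [c d] cl; congr pair.
- apply: hS => U V nU nV.
  have [||[x y] [/= Ux Vx]] := cl (U `*` setT) (V `*` setT).
  + by exists (U, setT) => //=; split => //; exact: filterT.
  + by exists (V, setT) => //=; split => //; exact: filterT.
  by exists x; split; [exact: Ux.1|exact: Vx.1].
- apply: hT => U V nU nV.
  have [||[x y] [/= Ux Vx]] := cl (setT `*` U) (setT `*` V).
  + by exists (setT, U) => //=; split => //; exact: filterT.
  + by exists (setT, V) => //=; split => //; exact: filterT.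
  by exists y; split; [exact: Ux.2|exact: Vx.2].
Qed.

Lemma paste_cont (S Z : topologicalType) (k : S -> R) (f g : S -> Z) :
  continuous k -> continuous f -> continuous g ->
  (forall x, k x = 0 -> f x = g x) ->
  continuous (fun x => if k x <= 0 then f x else g x).
Proof.
move=> ck cf cg fg; apply/continuous_closedP => C cC.
have -> : (fun x => if k x <= 0 then f x else g x) @^-1` C =
   (k @^-1` [set t | t <= 0] `&` f @^-1` C) `|`
   (k @^-1` [set t | 0 <= t] `&` g @^-1` C).
  apply/seteqP; split=> x /=; first by case: (lerP (k x) 0) => [|/ltW]; auto.
  case=> -[kx Cx]; first by rewrite kx.
  by case: ifPn => // kx'; rewrite fg//; apply/eqP; rewrite eq_le kx kx'.
have pc (T : topologicalType) (h : S -> T) D :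
  continuous h -> closed D -> closed (h @^-1` D) by move=> /continuous_closedP; apply.
apply: closedU; apply: closedI; apply: pc => //.
Qed.

(** A continuous map from a finite union of copies of a compact space to a
    Hausdorff space is closed, so continuity can be tested on the copies. *)
Lemma closed_glue (I : finType) (K S Z : topologicalType) (A : set K)
    (p : I -> K -> S) (k : I -> K -> Z) (g : S -> Z) (C : set Z) :
  compact A -> hausdorff_space S -> (forall i, continuous (p i)) ->
  (forall i, continuous (k i)) -> (forall i t, A t -> g (p i t) = k i t) ->
  closed C -> closed [set x | (exists i t, A t /\ p i t = x) /\ C (g x)].
Proof.
move=> cA hS cp ck gpk cC.
rewrite (_ : mkset _ =
  \bigcup_(i in [set: I]) (p i @` (A `&` k i @^-1` C))); last first.
  apply/seteqP; split=> x /=.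
    by move=> [[i [t [At <-]]] Cx]; exists i => //; exists t => //; split => //=; rewrite -gpk.
  by move=> [i _ [t [At Ct] <-]]; split; [exists i, t|rewrite gpk].
apply: closed_bigcup; first exact: finite_finset.
move=> i _; apply: compact_closed => //; apply: continuous_compact.
  exact: continuous_subspaceT.
apply: compact_closedI => //.
by move: (ck i) => /continuous_closedP; exact.
Qed.

Lemma exists_invn_lt (e : R) : 0 < e -> exists N, N.+1%:R^-1 < e.
Proof.
move=> e0; exists (Num.bound e^-1).
rewrite invf_plt ?posrE//; apply: (@lt_trans _ _ (Num.bound e^-1)%:R).
  by apply: archi_boundP; rewrite invr_ge0 ltW.
by rewrite ltr_nat.
Qed.

Lemma grid01 (N k : nat) : (k <= N.+1)%N -> 0 <= (k%:R / N.+1%:R : R) <= 1.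
Proof. by move=> kN; rewrite divr_ge0 ?ler0n//= ler_pdivrMr ?ltr0n// mul1r ler_nat. Qed.

End Basic.

(** * Graphs with edges labelled by the circles of a rose *)

(** A finite cover of the rose with [n] petals, in coordinates: [T] indexes the
    fibre over the base point, [edge u j] is the lift at [u] of the [j]-th
    petal, and [sig j] is the monodromy of that petal. The space itself is the
    quotient of the disjoint union of the edges because it is Hausdorff. *)
Record graph (R : realType) (Y : topologicalType) (T : finType) (n : nat) := Graph {
  graph_hausdorff : hausdorff_space Y;
  vt : T -> Y;
  edge : T -> 'I_n -> R -> Y;
  sig : 'I_n -> {perm T};
  edge_cont : forall u j, continuous (edge u j);
  edge0 : forall u j, edge u j 0 = vt u;
  edge1 : forall u j, edge u j 1 = vt (sig j u);
  edge_sur : forall y, exists u j t, 0 <= t <= 1 /\ edge u j t = y;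
  vt_inj : injective vt;
  edge_vt : forall u j t u', 0 < t < 1 -> edge u j t <> vt u';
  edge_inj : forall u j t u' j' t', 0 < t < 1 -> 0 < t' < 1 ->
    edge u j t = edge u' j' t' -> [/\ u = u', j = j' & t = t'] }.

Section Graph.
Context (R : realType) (Y : topologicalType) (T : finType) (n : nat).
Variable (G : graph R Y T n).
Local Notation edge := (edge G).
Local Notation vt := (vt G).
Local Notation sig := (sig G).

Lemma le01P (t : R) : 0 <= t <= 1 -> [\/ t = 0, t = 1 | 0 < t < 1].
Proof.
case/andP; rewrite le_eqVlt => /predU1P[<-|t0]; first by constructor 1.
rewrite le_eqVlt => /predU1P[->|t1]; first by constructor 2.
by constructor 3; rewrite t0.
Qed.

(** The coordinates of a point are unique except at the vertices, so this allows
    functions on the graph to be defined on coordinates. *)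
Lemma edge_eqP Z (h : T -> 'I_n -> R -> Z) (hv : T -> Z) :
  (forall u j, h u j 0 = hv u) -> (forall u j, h u j 1 = hv (sig j u)) ->
  forall u j t u' j' t', 0 <= t <= 1 -> 0 <= t' <= 1 ->
  edge u j t = edge u' j' t' -> h u j t = h u' j' t'.
Proof.
move=> h0 h1 u j t u' j' t' /le01P[->|->|t01] /le01P[->|->|t01'];
  rewrite ?edge0 ?edge1 ?h0 ?h1.
- by move/vt_inj => ->.
- by move/vt_inj => ->.
- by move=> /esym/edge_vt; case.
- by move/vt_inj => ->.
- by move/vt_inj => ->.
- by move=> /esym/edge_vt; case.
- by move=> /edge_vt; case.
- by move=> /edge_vt; case.
- by move=> /edge_inj; case=> // -> -> ->.
Qed.

Lemma unit_square_compact : compact (`[0, 1] `*` `[0, 1] : set (R * R)).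
Proof. by apply: compact_setX; exact: segment_compact. Qed.

(** The universal property of the graph as a quotient of its edges; the second
    coordinate is the time of a homotopy. *)
Lemma descend2 (Z : topologicalType) (g : T -> 'I_n -> R * R -> Z)
    (gv : T -> R -> Z) :
  (forall u j, continuous (g u j)) ->
  (forall u j s, 0 <= s <= 1 -> g u j (0, s) = gv u s) ->
  (forall u j s, 0 <= s <= 1 -> g u j (1, s) = gv (sig j u) s) ->
  exists2 H : Y * R -> Z, continuous H &
    forall u j t s, 0 <= t <= 1 -> 0 <= s <= 1 -> H (edge u j t, s) = g u j (t, s).
Proof.
move=> cg g0 g1.
have rp y : {p : T * 'I_n * R | 0 <= p.2 <= 1 /\ edge p.1.1 p.1.2 p.2 = y}.
  by apply: cid; have [u [j [t tP]]] := edge_sur G y; exists (u, j, t).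
pose H0 (x : Y * R) : Z := let p := sval (rp x.1) in g p.1.1 p.1.2 (p.2, x.2).
have H0E u j t s : 0 <= t <= 1 -> 0 <= s <= 1 -> H0 (edge u j t, s) = g u j (t, s).
  move=> t01 s01; rewrite /H0 /=; case: (rp _) => -[[u' j'] t'] /= [t'01 e].
  by apply: (@edge_eqP _ (fun u j t => g u j (t, s)) (fun u => gv u s)) e => // *;
    [exact: g0|exact: g1].
exists (fun x => H0 (x.1, clamp x.2)); last first.
  by move=> u j t s t01 s01 /=; rewrite clampK// H0E.
apply/continuous_closedP => C cC.
have cl : closed [set x | (exists (i : T * 'I_n) (t : R * R),
    (`[0, 1] `*` `[0, 1]) t /\ (edge i.1 i.2 t.1, t.2) = x) /\ C (H0 x)].
  apply: (@closed_glue (T * 'I_n)%type _ _ _ _ _ (fun i => g i.1 i.2)) cC.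
  - exact: unit_square_compact.
  - exact: hausdorff_pair (graph_hausdorff G) (@Rhausdorff R).
  - by move=> i; rcont; apply: cont_comp (@edge_cont _ _ _ _ G _ _); rcont.
  - by move=> i; exact: cg.
  - by move=> i [t s] [/= t01 s01]; rewrite H0E//; rewrite !in_itv in t01 s01.
rewrite (_ : _ @^-1` C = (fun x => (x.1, clamp x.2)) @^-1`
   [set x | (exists (i : T * 'I_n) (t : R * R),
    (`[0, 1] `*` `[0, 1]) t /\ (edge i.1 i.2 t.1, t.2) = x) /\ C (H0 x)]).
  have /continuous_closedP : continuous (fun x : Y * R => (x.1, clamp x.2)).
    by apply: cont_pair; [rcont|apply: cont_comp (@clamp_cont R); rcont].
  exact.
apply/seteqP; split=> x /= => [Cx|[]//]; split=> //.
have [u [j [t [t01 e]]]] := edge_sur G x.1.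
exists (u, j), (t, clamp x.2) => /=; rewrite e; split=> //; split => /=;
  rewrite in_itv//=; exact: clamp01.
Qed.

Lemma descend (Z : topologicalType) (g : T -> 'I_n -> R -> Z) (gv : T -> Z) :
  (forall u j, continuous (g u j)) ->
  (forall u j, g u j 0 = gv u) -> (forall u j, g u j 1 = gv (sig j u)) ->
  exists2 H : Y -> Z, continuous H &
    forall u j t, 0 <= t <= 1 -> H (edge u j t) = g u j t.
Proof.
move=> cg g0 g1.
have [|||H cH HE] := @descend2 Z (fun u j x => g u j x.1) (fun u _ => gv u).
- by move=> u j; apply: cont_comp (cg u j); rcont.
- by [].
- by [].
exists (fun y => H (y, 0)); first by apply: cont_comp cH; rcont.
by move=> u j t t01; rewrite HE// lexx ler01.
Qed.

Definition pcat (p q : R -> Y) (t : R) : Y :=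
  if 2 * t - 1 <= 0 then p (2 * t) else q (2 * t - 1).

Lemma pcat_cont (p q : R -> Y) : continuous p -> continuous q -> p 1 = q 0 ->
  continuous (pcat p q).
Proof.
move=> cp cq pq; apply: (@paste_cont R R Y (fun t => 2 * t - 1)).
- by rcont.
- by apply: cont_comp cp; rcont.
- by apply: cont_comp cq; rcont.
- by move=> x e; rewrite e (_ : 2 * x = 1) //; lra.
Qed.

Lemma pcat0 p q : pcat p q 0 = p 0.
Proof. by rewrite /pcat mulr0 sub0r lerN10. Qed.

Lemma pcat1 p q : pcat p q 1 = q 1.
Proof. by rewrite /pcat ifF; [congr q; lra|lra]. Qed.

Definition revp (p : R -> Y) (t : R) : Y := p (1 - t).

Lemma revp_cont (p : R -> Y) : continuous p -> continuous (revp p).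
Proof. by move=> cp; apply: cont_comp cp; rcont. Qed.

Definition avoids (i : 'I_n) (p : R -> Y) := forall t, 0 <= t <= 1 ->
  exists u j t', [/\ j != i, 0 <= t' <= 1 & edge u j t' = p t].

Lemma avoids_pcat i (p q : R -> Y) : avoids i p -> avoids i q -> avoids i (pcat p q).
Proof.
move=> ap aq t /andP[t0 t1]; rewrite /pcat; case: ifPn => h.
  by apply: ap; apply/andP; split; lra.
by apply: aq; rewrite -ltNge in h; apply/andP; split; lra.
Qed.

Lemma avoids_revp i p : avoids i p -> avoids i (revp p).
Proof. by move=> ap t /andP[t0 t1]; apply: ap; apply/andP; split; lra. Qed.

(** For loops spelled by a word [w] this is a lift of the automorphism that maps
    the [i]-th generator x to xw and fixes the other generators. *)
Definition transvection (i : 'I_n) (c : T -> R -> Y) (F : Y -> Y) :=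
  (forall u j t, 0 <= t <= 1 -> j != i -> F (edge u j t) = edge u j t) /\
  (forall u t, 0 <= t <= 1 -> F (edge u i t) = pcat (edge u i) (c (sig i u)) t).

Lemma transvection_exists i (c : T -> R -> Y) :
  (forall u, continuous (c u)) -> (forall u, c u 0 = vt u) ->
  (forall u, c u 1 = vt u) ->
  exists F : continuousType Y Y, transvection i c F.
Proof.
move=> cc c0 c1.
have [|||F cF FE] := @descend Y
  (fun u j => if j == i then pcat (edge u i) (c (sig i u)) else edge u j) vt.
- move=> u j; case: eqP => _; last exact: edge_cont.
  by apply: pcat_cont => //; [exact: edge_cont|rewrite edge1 c0].
- by move=> u j; case: eqP => _; rewrite ?pcat0 edge0.
- by move=> u j; case: eqP => [->|_]; rewrite ?pcat1 ?c1// edge1.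
exists (mkcts cF); split=> [u j t t01 /negPf ji|u t t01]; rewrite /= /mkcts FE//.
  by rewrite ji.
by rewrite eqxx.
Qed.

(** Applied to the loops of another transvection that prolongs the same edges; the
    one along the reversed loops is therefore a homotopy inverse. *)
Lemma transvection_fix i c F p t : transvection i c F -> avoids i p ->
  0 <= t <= 1 -> F (p t) = p t.
Proof.
by move=> [Fj Fi] ap /ap[u [j [t' [ji t01 <-]]]]; exact: Fj.
Qed.

(** The composition prolongs an edge e by the path that runs through c backwards
    and then forwards. During the first half of the homotopy this path is
    shortened to the constant path at its end, during the second half the
    resulting path, e followed by a constant path, is reparametrised. *)
Lemma transvection_homotopy i (c : T -> R -> Y) (F F' : continuousType Y Y) :
  (forall u, continuous (c u)) -> (forall u, c u 0 = vt u) ->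
  (forall u, c u 1 = vt u) -> (forall u, avoids i (c u)) ->
  transvection i c F -> transvection i (fun u => revp (c u)) F' ->
  homotopic R (F' \o F) idfun.
Proof.
move=> cc c0 c1 ac tF tF'.
(* In the point x = (t, s): [s1] and [s2] are the progress of the two halves,
   [al] is the position on the edge, and [be] the position on the loop, which
   runs from 1 down to [s1] and back; [b0] is the case [s1] = 0. The edge is
   used where [k] is nonpositive, that is for 4t <= 1 or in the second half. *)
pose s1 (x : R * R) : R := clamp (2 * x.2).
pose s2 (x : R * R) : R := clamp (2 * x.2 - 1).
pose al (x : R * R) : R := (1 - s2 x) * Num.min 1 (4 * x.1) + s2 x * x.1.
pose b0 (x : R * R) : R := Num.min 1 (Num.max (2 - 4 * x.1) (2 * x.1 - 1)).
pose be (x : R * R) : R := b0 x + s1 x * (1 - b0 x).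
pose k (x : R * R) : R := Num.min (4 * x.1 - 1) (2^-1 - x.2).
have cs1 : continuous s1 by apply: cont_comp (@clamp_cont R); rcont.
have cs2 : continuous s2 by apply: cont_comp (@clamp_cont R); rcont.
have cb0 : continuous b0 by rewrite /b0; rcont.
pose h u j (x : R * R) := if j == i then
   if k x <= 0 then edge u i (al x) else c (sig i u) (be x) else edge u j x.1.
have s20 x : x.2 <= 2^-1 -> s2 x = 0.
  by move=> xs; rewrite /s2 /clamp; apply/max_idPl; rewrite ge_min; apply/orP; right; lra.
have s11 x : 2^-1 <= x.2 -> s1 x = 1.
  by move=> xs; rewrite /s1 /clamp; rewrite (min_idPl _) ?(max_idPr _)//; lra.
have [|||H cH HE] := @descend2 Y h (fun u s => vt u).
- move=> u j; rewrite /h; case: eqP => _; last first.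
    by apply: cont_comp (@edge_cont _ _ _ _ G _ _); rcont.
  apply: paste_cont.
  + by rewrite /k; rcont.
  + by apply: cont_comp (@edge_cont _ _ _ _ G _ _); rewrite /al; rcont.
  + by apply: cont_comp (cc _); rewrite /be; rcont.
  + move=> x kx.
    have [x1 x2] : 4 * x.1 - 1 >= 0 /\ 2^-1 - x.2 >= 0.
      by apply/andP; rewrite -le_min -/(k x) kx.
    have -> : al x = 1.
      rewrite /al s20; last lra.
      by rewrite subr0 mul0r addr0 mul1r; apply/min_idPl; lra.
    have -> : be x = 1.
      rewrite /be; move: kx; rewrite /k; case: (leP (4 * x.1 - 1) (2^-1 - x.2)) => _ kx.
        have -> : b0 x = 1; last by rewrite subrr mulr0 addr0.
        apply/min_idPl; rewrite le_max; apply/orP; left; lra.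
      by rewrite s11; [lra|lra].
    by rewrite edge1 c1.
- move=> u j s s01; rewrite /h; case: eqP => _; last by rewrite edge0.
  rewrite ifT; last by rewrite /k ge_min /=; apply/orP; left; lra.
  rewrite -(edge0 G u i); congr (edge u i _); rewrite /al /=.
  by rewrite !mulr0 addr0 (min_idPr _) ?mulr0.
- move=> u j s s01; rewrite /h; case: eqP => [->|_]; last by rewrite edge1.
  case: ifP => _.
    rewrite -(edge1 G u i); congr (edge u i _); rewrite /al /=.
    by rewrite (min_idPl _); lra.
  rewrite -[in RHS](c1 (sig i u)); congr (c _ _); rewrite /be.
  have -> : b0 (1, s) = 1; last lra.
  by rewrite /b0 /= (max_idPr _) ?(min_idPl _); lra.
exists H; split.
- exact: continuous_subspaceT.
- move=> y; have [u [j [t [t01 <-]]]] := edge_sur G y.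
  rewrite HE ?lexx ?ler01//= /h.
  case: (tF) => [Fj Fi]; case: (tF') => [Fj' Fi'].
  have [->|ji] := eqVneq j i; last by rewrite Fj// Fj'.
  case/andP: (t01) => t0 t1.
  have s20' : s2 (t, 0) = 0 by rewrite s20//=; lra.
  have s10' : s1 (t, 0) = 0 by rewrite /s1 /= mulr0 clamp0.
  rewrite Fi// /al /be s20' s10' mul0r addr0 mul0r addr0 subr0 mul1r /=.
  rewrite /k /= {1}/pcat; have [h2|h2] := lerP (2 * t - 1) 0; last first.
    rewrite ifF; last by apply/negbTE; rewrite -ltNge lt_min; apply/andP; split; lra.
    have -> : b0 (t, 0) = 2 * t - 1 by rewrite /b0 /= (max_idPr _) ?(min_idPr _); lra.
    by rewrite (transvection_fix tF' (ac _)) //; lra.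
  rewrite Fi' /pcat; last by lra.
  have [h4|h4] := lerP (2 * (2 * t) - 1) 0.
    rewrite ifT; last by rewrite ge_min; apply/orP; left; lra.
    by congr (edge _ _ _); rewrite (min_idPr _); lra.
  rewrite ifF; last by apply/negbTE; rewrite -ltNge lt_min; apply/andP; split; lra.
  rewrite /revp; congr (c _ _).
  by rewrite /b0 /= (max_idPl _) ?(min_idPr _); lra.
- move=> y; have [u [j [t [t01 <-]]]] := edge_sur G y.
  rewrite HE ?lexx ?ler01//= /h.
  have [->|ji] := eqVneq j i => //.
  rewrite ifT; last by rewrite /k /= ge_min; apply/orP; right; lra.
  have -> : al (t, 1) = t; last by [].
  rewrite /al; have -> : s2 (t, 1) = 1 by rewrite /s2 /= (_ : 2 * 1 - 1 = 1) ?clamp1//; lra.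
  by rewrite subrr mul0r add0r mul1r.
Qed.

Lemma transvection_equivalence i (c : T -> R -> Y) (F : continuousType Y Y) :
  (forall u, continuous (c u)) -> (forall u, c u 0 = vt u) ->
  (forall u, c u 1 = vt u) -> (forall u, avoids i (c u)) ->
  transvection i c F -> homotopy_equivalence R F.
Proof.
move=> cc c0 c1 ac tF.
have cr u : continuous (revp (c u)) by exact: revp_cont.
have r0 u : revp (c u) 0 = vt u by rewrite /revp subr0.
have r1 u : revp (c u) 1 = vt u by rewrite /revp subrr.
have [F' tF'] := transvection_exists i cr r0 r1.
exists F'; split; first exact: (transvection_homotopy cc c0 c1 ac tF tF').
apply: (transvection_homotopy cr r0 r1 _ tF'); first by move=> u; exact: avoids_revp.
rewrite (_ : (fun u => revp (revp (c u))) = c)//.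
by apply/funext => u; apply/funext => t; rewrite /revp; congr (c _ _); lra.
Qed.

End Graph.

(** Applied to the covering map this says that a transvection upstairs lifts the
    one downstairs; applied to a deck transformation it says that they
    commute. *)
Lemma transvection_natural (R : realType) (n : nat) (Y Y' : topologicalType)
    (T T' : finType) (G : graph R Y T n) (G' : graph R Y' T' n)
    (f : Y -> Y') (tau : T -> T') i c c' F F' :
  (forall u j t, 0 <= t <= 1 -> f (edge G u j t) = edge G' (tau u) j t) ->
  (forall u t, 0 <= t <= 1 -> f (c u t) = c' (tau u) t) ->
  transvection G i c F -> transvection G' i c' F' ->
  forall y, f (F y) = F' (f y).
Proof.
move=> fe fc [Fj Fi] [Fj' Fi'] y.
have [u [j [t [t01 <-]]]] := edge_sur G y; case/andP: (t01) => t0 t1.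
rewrite fe//; have [->|ji] := eqVneq j i; last by rewrite Fj// Fj'// fe.
have ts : tau (sig G i u) = sig G' i (tau u).
  apply: (@vt_inj _ _ _ _ G'); rewrite -edge1 -fe ?lexx ?ler01// edge1.
  by rewrite -(edge0 G _ i) -(edge0 G' _ i) fe// lexx ler01.
rewrite Fi// Fi'// /pcat; case: ifPn => h; first by rewrite fe//; lra.
by rewrite -ltNge in h; rewrite fc ?ts//; lra.
Qed.

(** * Singular simplices of dimension at most two as maps of real variables *)

Definition o0 {k} : 'I_k.+1 := ord0.
Definition o1 {k} : 'I_k.+2 := @Ordinal k.+2 1 isT.
Definition o2 {k} : 'I_k.+3 := @Ordinal k.+3 2 isT.

Lemma sum2 (M : nmodType) (F : 'I_2 -> M) : \sum_j F j = F o0 + F o1.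
Proof.
rewrite !big_ord_recl big_ord0 addr0; congr (F _ + F _); exact/val_inj.
Qed.

Lemma sum3 (M : nmodType) (F : 'I_3 -> M) : \sum_j F j = F o0 + F o1 + F o2.
Proof.
rewrite !big_ord_recl big_ord0 addr0 addrA.
congr (F _ + F _ + F _); exact/val_inj.
Qed.

Lemma ord2P (j : 'I_2) : j = o0 \/ j = o1.
Proof. by case: j => [[|[|]]] //= h; [left|right]; apply/val_inj. Qed.

Lemma ord3P (j : 'I_3) : [\/ j = o0, j = o1 | j = o2].
Proof.
by case: j => [[|[|[|]]]] //= h; [constructor 1|constructor 2|constructor 3];
  apply/val_inj.
Qed.

Section Simplices.
Context (R : realType).

Definition coef k (j : 'I_k.+1) (t : @std_simplex R k) : R := \val t 0 j.

Lemma coef_cont k (j : 'I_k.+1) : continuous (coef j).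
Proof.
have cv : continuous (\val : @std_simplex R k -> 'rV[R]_k.+1).
  exact: initial_continuous.
by apply: cont_comp cv (@coord_continuous _ _ _ _ _).
Qed.

Lemma coef_sum k (t : @std_simplex R k) : \sum_j coef j t = 1.
Proof. by case: t => t tP; have := tP; rewrite inE => -[]. Qed.

Lemma coef_ge0 k (t : @std_simplex R k) j : 0 <= coef j t.
Proof. by case: t => t tP; have := tP; rewrite inE => -[+ _]; exact. Qed.

Lemma simplex_eq k (s t : @std_simplex R k) :
  (forall j, coef j s = coef j t) -> s = t.
Proof. by move=> e; apply/val_inj/rowP. Qed.

Lemma simplex_cont (S : topologicalType) k (f : S -> @std_simplex R k) :
  (forall j, continuous (fun x => coef j (f x))) -> continuous f.
Proof.
move=> cf; apply: continuous_comp_initial => x A [P] nP PA.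
suff H : \forall y \near x, forall a j, P a j (\val (f y) a j).
  by apply: filterS H => y Py; exact: PA.
apply: filter_forall => a; apply: filter_forall => j.
by rewrite (ord1 a); apply: cf; have := nP a j; rewrite (ord1 a).
Qed.

Lemma mksimplex_subproof k (w : 'I_k.+1 -> R) :
  (forall j, 0 <= w j) -> \sum_j w j = 1 ->
  (\row_j w j : 'rV[R]_k.+1) \in @std_simplex R k.
Proof.
move=> w0 w1; rewrite inE; split=> [j|]; first by rewrite mxE.
by under eq_bigr do rewrite mxE.
Qed.

Definition interval_weight (t : R) (j : 'I_2) := nth 0 [:: 1 - clamp t; clamp t] j.
(** The unit square mapped onto the triangle: the side x = 0 is collapsed to the
    first vertex, and the other three sides become the three faces. *)
Definition square_weight (x : R * R) (j : 'I_3) :=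
  nth 0 [:: 1 - clamp x.1; clamp x.1 * (1 - clamp x.2); clamp x.1 * clamp x.2] j.

Lemma interval_weight_ge0 t j : 0 <= interval_weight t j.
Proof.
by have /andP[? ?] := clamp01 t; case: (ord2P j) => ->; rewrite /interval_weight //= subr_ge0.
Qed.

Lemma interval_weight_sum t : \sum_j interval_weight t j = 1.
Proof. by rewrite sum2 /interval_weight /=; lra. Qed.

Lemma square_weight_ge0 x j : 0 <= square_weight x j.
Proof.
have /andP[? ?] := clamp01 x.1; have /andP[? ?] := clamp01 x.2.
by case: (ord3P j) => ->; rewrite /square_weight /=; rewrite ?mulr_ge0 ?subr_ge0.
Qed.

Lemma square_weight_sum x : \sum_j square_weight x j = 1.
Proof. by rewrite sum3 /square_weight /=; lra. Qed.

Definition pt1 t : @std_simplex R 1 :=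
  exist (fun x => x \in @std_simplex R 1) _
    (mksimplex_subproof (interval_weight_ge0 t) (interval_weight_sum t)).
Definition pt2 x : @std_simplex R 2 :=
  exist (fun x => x \in @std_simplex R 2) _
    (mksimplex_subproof (square_weight_ge0 x) (square_weight_sum x)).

Lemma coef_pt1 t j : coef j (pt1 t) = interval_weight t j.
Proof. by rewrite /coef /= mxE. Qed.

Lemma coef_pt2 t j : coef j (pt2 t) = square_weight t j.
Proof. by rewrite /coef /= mxE. Qed.

Lemma cclamp (S : topologicalType) (f : S -> R) :
  continuous f -> continuous (fun x => clamp (f x)).
Proof. by move=> cf; apply: cont_comp cf (@clamp_cont R). Qed.

Lemma pt1_cont : continuous pt1.
Proof.
apply: simplex_cont => j.
rewrite (_ : (fun x => _) = interval_weight^~ j); last by apply/funext => x; exact: coef_pt1.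
have c : continuous (fun x : R => clamp x) by apply: cclamp; rcont.
by case: (ord2P j) => ->; rewrite /interval_weight /=; rcont.
Qed.

Lemma pt2_cont : continuous pt2.
Proof.
apply: simplex_cont => j.
rewrite (_ : (fun x => _) = square_weight^~ j); last by apply/funext => x; exact: coef_pt2.
have c : continuous (fun x : R * R => clamp x.1) by apply: cclamp; rcont.
have c' : continuous (fun x : R * R => clamp x.2) by apply: cclamp; rcont.
by case: (ord3P j) => ->; rewrite /square_weight /=; rcont.
Qed.

Lemma coef1_01 (t : @std_simplex R 1) : 0 <= coef o1 t <= 1.
Proof.
have := coef_sum t; rewrite sum2 => s.
by have := coef_ge0 t o0; have := coef_ge0 t o1; move=> ? ?; apply/andP; split; lra.
Qed.

Lemma pt1K (t : @std_simplex R 1) : pt1 (coef o1 t) = t.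
Proof.
apply: simplex_eq => j; rewrite coef_pt1 /interval_weight clampK ?coef1_01//.
have := coef_sum t; rewrite sum2 => s.
by case: (ord2P j) => -> /=; lra.
Qed.

Section Space.
Context (Y : topologicalType).
Implicit Types p q r : continuousType R Y.

Lemma spath_cont p : continuous (fun t : @std_simplex R 1 => p (coef o1 t)).
Proof. by apply: cont_comp (@coef_cont 1 o1) _; exact: cts_fun. Qed.

(** Every singular 1-simplex is of this form, see [path_ofK]. *)
Definition spath p : singular_simplex R 1 Y := mkcts (@spath_cont p).

Lemma spathE p t : spath p t = p (coef o1 t). Proof. by []. Qed.

Lemma eq_spath p q : (forall t, 0 <= t <= 1 -> p t = q t) -> spath p = spath q.
Proof. by move=> e; apply/continuousEP => t; rewrite !spathE e// coef1_01. Qed.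

Lemma path_of_cont (s : singular_simplex R 1 Y) : continuous (fun t => s (pt1 t)).
Proof. by apply: cont_comp pt1_cont _; exact: cts_fun. Qed.

Definition path_of (s : singular_simplex R 1 Y) : continuousType R Y :=
  mkcts (@path_of_cont s).

Lemma path_ofK s : spath (path_of s) = s.
Proof. by apply/continuousEP => t; rewrite spathE /= /mkcts pt1K. Qed.

(** Arguments in degree one are carried out for an arbitrary cocycle with values
    in an abelian group; the group of 1-chains modulo a subgroup containing the
    boundaries gives statements about homology. *)
Definition cocycle (M : zmodType) (l : singular_simplex R 1 Y -> M) :=
  forall s : singular_simplex R 2 Y,
    l (s \o face o1 : singular_simplex R 1 Y) =
    l (s \o face o2 : singular_simplex R 1 Y) +
    l (s \o face o0 : singular_simplex R 1 Y).

Lemma coef_face k i j (t : @std_simplex R k) :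
  coef j (face i t) = if unlift i j is Some j' then coef j' t else 0.
Proof. by rewrite /coef /= mxE. Qed.

Lemma unlift_o (i j : 'I_3) j' : j = fintype.lift i j' -> unlift i j = Some j'.
Proof. by move=> ->; rewrite liftK. Qed.

Lemma coef_face0 (t : @std_simplex R 1) :
  [/\ coef o0 (face o0 t) = 0, coef o1 (face o0 t) = coef o0 t
    & coef o2 (face o0 t) = coef o1 t].
Proof.
rewrite !coef_face unlift_none (unlift_o (j' := o0)) ?(unlift_o (j' := o1)) //;
  exact/val_inj.
Qed.

Lemma coef_face1 (t : @std_simplex R 1) :
  [/\ coef o0 (face o1 t) = coef o0 t, coef o1 (face o1 t) = 0
    & coef o2 (face o1 t) = coef o1 t].
Proof.
rewrite !coef_face unlift_none (unlift_o (j' := o0)) ?(unlift_o (j' := o1)) //;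
  exact/val_inj.
Qed.

Lemma coef_face2 (t : @std_simplex R 1) :
  [/\ coef o0 (face o2 t) = coef o0 t, coef o1 (face o2 t) = coef o1 t
    & coef o2 (face o2 t) = 0].
Proof.
rewrite !coef_face unlift_none (unlift_o (j' := o0)) ?(unlift_o (j' := o1)) //;
  exact/val_inj.
Qed.

Lemma coef0E (t : @std_simplex R 1) : coef o0 t = 1 - coef o1 t.
Proof. by have := coef_sum t; rewrite sum2 => s; lra. Qed.

Definition seg (h : R * R -> Y) (A B : R * R) (t : R) : Y :=
  h (A.1 + t * (B.1 - A.1), A.2 + t * (B.2 - A.2)).

(** The singular triangle obtained by restricting [h] to the affine triangle with
    vertices [A], [B], [C]. *)
Lemma cocycle_triangle (M : zmodType) (l : singular_simplex R 1 Y -> M)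
    (h : R * R -> Y) A B C p q r : cocycle l -> continuous h ->
  (forall t, 0 <= t <= 1 -> p t = seg h A B t) ->
  (forall t, 0 <= t <= 1 -> q t = seg h B C t) ->
  (forall t, 0 <= t <= 1 -> r t = seg h A C t) ->
  l (spath r) = l (spath p) + l (spath q).
Proof.
move=> cl ch ep eq er.
have cs : continuous (fun t : @std_simplex R 2 =>
   h (coef o0 t * A.1 + coef o1 t * B.1 + coef o2 t * C.1,
      coef o0 t * A.2 + coef o1 t * B.2 + coef o2 t * C.2)).
  by have cf := @coef_cont 2; apply: cont_comp ch; rcont; exact: cf.
pose s : singular_simplex R 2 Y := mkcts cs.
suff [-> -> ->] : [/\ spath p = (s \o face o2 : singular_simplex R 1 Y),
  spath q = (s \o face o0 : singular_simplex R 1 Y)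
  & spath r = (s \o face o1 : singular_simplex R 1 Y)] by exact: cl.
split; apply/continuousEP => t.
- rewrite spathE ep ?coef1_01 //= /mkcts /seg /=.
  have [-> -> ->] := coef_face2 t.
  by congr (h (_, _)); rewrite coef0E; ring.
- rewrite spathE eq ?coef1_01 //= /mkcts /seg /=.
  have [-> -> ->] := coef_face0 t.
  by congr (h (_, _)); rewrite coef0E; ring.
- rewrite spathE er ?coef1_01 //= /mkcts /seg /=.
  have [-> -> ->] := coef_face1 t.
  by congr (h (_, _)); rewrite coef0E; ring.
Qed.

End Space.
End Simplices.

(** * Lebesgue numbers *)

Section Lebesgue.
Context (R : realType).

Lemma lebesgue_number (V : pseudoMetricType R) (K : set V) (Q : set V -> Prop) :
  compact K -> (forall A B, A `<=` B -> Q B -> Q A) ->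
  (forall x, K x -> exists2 A, nbhs x A & Q A) ->
  exists2 e : R, 0 < e & forall x, K x -> Q (ball x e).
Proof.
move=> /compact_near_coveringP cK mono loc.
have [] := cK R (0^'+)%R (fun e x => Q (ball x e)) _ _.
  move=> x /loc[A /nbhs_ballP[d /= d0 dA] QA].
  exists (ball x (d / 2), [set e | 0 < e < d / 2]) => /=.
    split; first by apply: nbhsx_ballx; rewrite divr_gt0.
    near=> e; apply/andP; split => //; near: e; apply: nbhs_right_lt.
    by rewrite divr_gt0.
  move=> [x' e] /= [xx' /andP[e0 ed]]; apply: mono QA => z x'z; apply: dA.
  rewrite [d]splitr; apply: (ball_triangle xx').
  by apply: le_ball x'z; exact: ltW.
move=> e /= e0 eP.
exists (e / 2) => [|x Kx]; first by rewrite divr_gt0.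
apply: (eP (e / 2)) => //=; last by rewrite divr_gt0.
by rewrite sub0r normrN gtr0_norm ?divr_gt0 // gtr_pMr // invf_lt1 // ltr1n.
Unshelve. all: by end_near. Qed.

Lemma lebesgue_unit (Q : set R -> Prop) :
  (forall A B, A `<=` B -> Q B -> Q A) ->
  (forall x : R, 0 <= x <= 1 -> exists2 A : set R, nbhs x A & Q A) ->
  exists N, forall x : R, 0 <= x <= 1 -> Q [set y | `|x - y| <= N.+1%:R^-1].
Proof.
move=> mono loc.
have [|e e0 eP] := @lebesgue_number R `[0, 1] Q (@segment_compact R 0 1) mono.
  by move=> x; rewrite /= in_itv /=; exact: loc.
have [N Ne] := exists_invn_lt e0; exists N => x x01.
apply: mono (eP x _); last by rewrite /= in_itv.
by move=> y /= xy; apply: le_lt_trans Ne.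
Qed.

End Lebesgue.

(** * Cocycles of paths in a graph *)

Section Cocycle.
Context (R : realType) (Y : topologicalType) (M : zmodType).
Variable l : singular_simplex R 1 Y -> M.
Hypothesis cl : cocycle l.
Implicit Types p q r b v : continuousType R Y.

Lemma cocycle_cst p y : (forall t, 0 <= t <= 1 -> p t = y) -> l (spath p) = 0.
Proof.
move=> py; apply: (@addrI _ (l (spath p))); rewrite addr0.
have ch : continuous (fun _ : R * R => y) by exact: cont_cst.
by rewrite -(@cocycle_triangle _ _ _ _ _ 0 0 0 _ _ p cl ch).
Qed.

Lemma subpath_cont p (a b : R) : continuous (fun t : R => p (a + t * (b - a))).
Proof.
by apply: cont_comp (@cts_fun _ _ p); rcont.
Qed.

Definition subpath p (a b : R) : continuousType R Y := mkcts (@subpath_cont p a b).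

Lemma subpathE p (a b t : R) : subpath p a b t = p (a + t * (b - a)). Proof. by []. Qed.

Lemma cocycle_subpath p (a b c : R) :
  l (spath (subpath p a c)) = l (spath (subpath p a b)) + l (spath (subpath p b c)).
Proof.
have ch : continuous (fun x : R * R => p x.1).
  by apply: cont_comp (@cts_fun _ _ p); rcont.
by apply: (@cocycle_triangle _ _ _ _ _ (a, 0) (b, 0) (c, 0) _ _ _ cl ch).
Qed.

Lemma cocycle_subpath0 p a : l (spath (subpath p a a)) = 0.
Proof. by apply: (@cocycle_cst _ (p a)) => t _; rewrite subpathE subrr mulr0 addr0. Qed.

Lemma cocycle_revp p q : (forall t, 0 <= t <= 1 -> q t = p (1 - t)) ->
  l (spath q) = - l (spath p).
Proof.
move=> e; have := cocycle_subpath p 0 1 0; rewrite cocycle_subpath0.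
rewrite (eq_spath (p := subpath p 0 1) (q := p)); last by move=> t _; rewrite subpathE; congr (p _); ring.
rewrite (eq_spath (p := subpath p 1 0) (q := q)); last first.
  by move=> t t01; rewrite subpathE e//; congr (p _); ring.
by move/eqP; rewrite eq_sym addrC addr_eq0 => /eqP.
Qed.

Lemma cocycle_pcat p q r : p 1 = q 0 ->
  (forall t, 0 <= t <= 1 -> r t = pcat p q t) ->
  l (spath r) = l (spath p) + l (spath q).
Proof.
move=> pq e.
have cpq : continuous (pcat p q) by apply: pcat_cont => //; exact: cts_fun.
pose pq' : continuousType R Y := mkcts cpq.
rewrite (eq_spath (q := subpath pq' 0 1)); last first.
  by move=> t t01; rewrite subpathE /= /mkcts e//; congr (pcat _ _ _); ring.
rewrite (@cocycle_subpath _ _ 2^-1); congr (l _ + l _); apply: eq_spath => t /andP[t0 t1].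
  rewrite subpathE /= /mkcts /pcat ifT; last lra.
  by congr (p _); lra.
rewrite subpathE /= /mkcts /pcat; case: ifPn => h; last by congr (q _); lra.
have -> : t = 0 by apply/eqP; rewrite eq_le t0 andbT; lra.
by rewrite -pq; congr (p _); lra.
Qed.

Lemma cocycle_square (h : R * R -> Y) (p b v0 v1 : continuousType R Y) : continuous h ->
  (forall t, 0 <= t <= 1 -> p t = h (t, 1)) ->
  (forall t, 0 <= t <= 1 -> b t = h (t, 0)) ->
  (forall t, 0 <= t <= 1 -> v0 t = h (0, t)) ->
  (forall t, 0 <= t <= 1 -> v1 t = h (1, t)) ->
  l (spath v0) + l (spath p) = l (spath b) + l (spath v1).
Proof.
move=> ch ep eb e0 e1.
have cd : continuous (fun t : R => h (t, t)) by apply: cont_comp ch; rcont.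
pose d : continuousType R Y := mkcts cd.
rewrite -(@cocycle_triangle _ _ _ l h (0, 0) (0, 1) (1, 1) v0 p d cl ch).
- apply: (@cocycle_triangle _ _ _ l h (0, 0) (1, 0) (1, 1) b v1 d cl ch).
  + by move=> t t01; rewrite eb// /seg /=; congr (h (_, _)); ring.
  + by move=> t t01; rewrite e1// /seg /=; congr (h (_, _)); ring.
  + by move=> t t01; rewrite /seg /= /mkcts; congr (h (_, _)); ring.
- by move=> t t01; rewrite e0// /seg /=; congr (h (_, _)); ring.
- by move=> t t01; rewrite ep// /seg /=; congr (h (_, _)); ring.
- by move=> t t01; rewrite /seg /= /mkcts; congr (h (_, _)); ring.
Qed.

End Cocycle.

Section Exact.
Context (R : realType) (Y : topologicalType) (T : finType) (n : nat).
Variable (G : graph R Y T n).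
Local Notation edge := (edge G).
Local Notation vt := (vt G).
Local Notation sig := (sig G).

Definition edgep u j : continuousType R Y := mkcts (@edge_cont _ _ _ _ G u j).

Variables (M : zmodType) (l : singular_simplex R 1 Y -> M).
Hypothesis cl : cocycle l.

(* At both ends of an edge [phiE] forces [l] to vanish on that edge; conversely
   this is all that is needed for [phi] to exist. *)
Variable phi : Y -> M.
Hypothesis phiE : forall u j t, 0 <= t <= 1 ->
  phi (edge u j t) = l (spath (subpath (edgep u j) 0 t)).

(** A self-map [c] of the interval that fixes the end points acts on all edges at
    once, and the resulting map of the graph is homotopic to the identity. The
    points move within their edges, where the cocycle is known to be the
    variation of [phi]. *)
Section Collapse.
Variable c : R -> R.
Hypothesis cc : continuous c.
Hypothesis c0 : c 0 = 0.
Hypothesis c1 : c 1 = 1.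
Hypothesis c01 : forall t, 0 <= t <= 1 -> 0 <= c t <= 1.

Lemma collapse_exists : exists2 D : Y * R -> Y, continuous D &
  forall u j t r, 0 <= t <= 1 -> 0 <= r <= 1 ->
    D (edge u j t, r) = edge u j (c t + r * (t - c t)).
Proof.
apply: (@descend2 _ _ _ _ G _
  (fun u j x => edge u j (c x.1 + x.2 * (x.1 - c x.1))) (fun u _ => vt u)).
- move=> u j; apply: cont_comp (@edge_cont _ _ _ _ G _ _).
  have cc1 : continuous (fun x : R * R => c x.1) by apply: cont_comp cc; rcont.
  by rcont.
- by move=> u j s _ /=; rewrite c0 subrr mulr0 addr0 edge0.
- by move=> u j s _ /=; rewrite c1 subrr mulr0 addr0 edge1.
Qed.

Variable D : Y * R -> Y.
Hypothesis cD : continuous D.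
Hypothesis DE : forall u j t r, 0 <= t <= 1 -> 0 <= r <= 1 ->
    D (edge u j t, r) = edge u j (c t + r * (t - c t)).

Lemma collapse_track y (v : continuousType R Y) :
  (forall t, 0 <= t <= 1 -> v t = D (y, t)) ->
  l (spath v) = phi y - phi (D (y, 0)).
Proof.
have [u [j [t [t01 <-]]]] := edge_sur G y => ev.
rewrite DE ?lexx ?ler01// mul0r addr0 !phiE ?c01//.
rewrite (cocycle_subpath cl _ 0 (c t) t) addrAC subrr add0r; congr (l _).
by apply: eq_spath => r r01; rewrite ev// DE// subpathE.
Qed.

Lemma collapse_path (p : continuousType R Y) y :
  (forall t, 0 <= t <= 1 -> D (p t, 0) = y) ->
  l (spath p) = phi (p 1) - phi (p 0).
Proof.
move=> py.
have ch : continuous (fun x : R * R => D (p x.1, x.2)).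
  have cp := @cts_fun _ _ p.
  apply: cont_comp cD; rcont; by apply: cont_comp cp; rcont.
have cv x : continuous (fun t : R => D (p x, t)).
  by apply: cont_comp cD; rcont.
pose v x : continuousType R Y := mkcts (cv x).
have cb : continuous (fun t : R => D (p t, 0)).
  by apply: cont_comp cD; rcont.
pose b : continuousType R Y := mkcts cb.
have D1 z : D (z, 1) = z.
  have [u [j [t [t01 <-]]]] := edge_sur G z.
  by rewrite DE ?lexx ?ler01//; congr (edge _ _ _); ring.
have := @cocycle_square _ _ _ l cl (fun x : R * R => D (p x.1, x.2)) p b (v 0) (v 1)
  ch (fun t _ => esym (D1 _)) (fun t _ => erefl) (fun t _ => erefl) (fun t _ => erefl).
rewrite (cocycle_cst (p := b) cl py) add0r.
have i0 : 0 <= (0 : R) <= 1 by rewrite lexx ler01.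
have i1 : 0 <= (1 : R) <= 1 by rewrite lexx ler01.
have -> : l (spath (v 0)) = phi (p 0) - phi y.
  by rewrite (@collapse_track (p 0)) // py.
have -> : l (spath (v 1)) = phi (p 1) - phi y.
  by rewrite (@collapse_track (p 1)) // py.
move=> /(congr1 (fun z => z - (phi (p 0) - phi y))).
rewrite addrAC subrr add0r => ->.
by rewrite opprB addrA subrK.
Qed.

End Collapse.

(** The other values form a finite, hence closed, set. *)
Lemma finite_local_cst (S : topologicalType) (g : S -> Y) (W : set S)
    (F : set Y) x : continuous g -> open W -> W x -> finite_set F ->
  (forall z, W z -> F (g z)) ->
  exists2 A : set S, nbhs x A & forall z, A z -> g z = g x.
Proof.
move=> cg oW Wx fF gF.
exists (W `&` g @^-1` (~` (F `\ g x))).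
  apply: filterI; first exact: open_nbhs_nbhs.
  apply: cg; apply: open_nbhs_nbhs; split; last by move=> [_]; exact.
  apply: closed_openC.
  have /accessible_finite_set_closed := hausdorff_accessible (graph_hausdorff G).
  by apply; apply: sub_finite_set fF => z [].
by move=> z [/gF Fz /= nFz]; apply: contrapT => zx; apply: nFz; split.
Qed.

(** Near a point of the graph one of two collapses is locally constant: the one
    that pushes the outer thirds of all edges to the vertices, or the one that
    contracts the middle halves to the midpoints. So [collapse_path] applies to
    all short pieces of a path. *)
Lemma local_exact (p : continuousType R Y) (x : R) :
  exists2 A : set R, nbhs x A &
   forall a b, (forall t, 0 <= t <= 1 -> A (a + t * (b - a))) ->
     l (spath (subpath p a b)) = phi (p b) - phi (p a).
Proof.
(* the distance to the midpoint of the edge tells the two cases apart *)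
have [k ck kE] : exists2 k : Y -> R, continuous k &
    forall u j t, 0 <= t <= 1 -> k (edge u j t) = `|t - 2^-1|.
  apply: (@descend _ _ _ _ G R (fun _ _ t => `|t - 2^-1|) (fun _ => 2^-1)).
  - move=> u j; apply: cont_comp (@norm_continuous _ R); by rcont.
  - by move=> u j; rewrite sub0r normrN gtr0_norm// invr_gt0.
  - by move=> u j; rewrite (_ : 1 - 2^-1 = 2^-1) ?gtr0_norm ?invr_gt0//; lra.
have cp := @cts_fun _ _ p.
have key (c : R -> R) (W : set Y) (F : set Y) : continuous c -> c 0 = 0 -> c 1 = 1 ->
    (forall t, 0 <= t <= 1 -> 0 <= c t <= 1) -> open W -> finite_set F ->
    (forall u j t, 0 <= t <= 1 -> W (edge u j t) -> F (edge u j (c t))) ->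
    W (p x) -> exists2 A : set R, nbhs x A &
   forall a b, (forall t, 0 <= t <= 1 -> A (a + t * (b - a))) ->
     l (spath (subpath p a b)) = phi (p b) - phi (p a).
  move=> cc c0 c1 c01 oW fF WF Wx.
  have [D cD DE] := collapse_exists cc c0 c1.
  have cDp : continuous (fun t : R => D (p t, 0)) by apply: cont_comp cD; rcont.
  have oW' : open (p @^-1` W) by move/continuousP: cp; exact.
  have [] := @finite_local_cst _ (fun t : R => D (p t, 0)) _ F x cDp oW' Wx fF.
    move=> z /=; have [u [j [t [t01 <-]]]] := edge_sur G (p z) => Wz.
    by rewrite DE ?lexx ?ler01// mul0r addr0; exact: WF.
  move=> A nA AE; exists A => // a b Aab.
  rewrite (@collapse_path c c01 D cD DE _ (D (p x, 0))).
    by rewrite !subpathE; congr (phi (p _) - phi (p _)); ring.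
  by move=> t t01; rewrite subpathE; apply: AE; exact: Aab.
have [kx|kx] := ltP (6^-1) (k (p x)).
- apply: (key (fun t => clamp (3 * t - 1)) (k @^-1` [set z | 6^-1 < z]) (range vt)) => //.
  + by apply: cclamp; rcont.
  + by rewrite /clamp; rewrite (min_idPr _) ?(max_idPl _)//; lra.
  + by rewrite (_ : 3 * 1 - 1 = 2) ?/clamp; [rewrite (min_idPl _) ?(max_idPr _)//; lra|lra].
  + by move=> t _; exact: clamp01.
  + by move/continuousP: ck; apply; exact: open_gt.
  + by apply: finite_image; exact: finite_finset.
  + move=> u j t t01 /=; rewrite kE// ltr_normr => /orP[h|h].
    * exists (sig j u) => //; rewrite -edge1; congr (edge _ _ _).
      by rewrite /clamp (min_idPl _) ?(max_idPr _)//; lra.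
    * exists u => //; rewrite -(edge0 G u j); congr (edge _ _ _).
      by rewrite /clamp (min_idPr _) ?(max_idPl _)//; lra.
- apply: (key (fun t => Num.min (2 * t) (Num.max 2^-1 (2 * t - 1)))
    (k @^-1` [set z | z < 4^-1]) (range (fun x : T * 'I_n => edge x.1 x.2 2^-1))) => //.
  + by rcont.
  + by rewrite mulr0 (min_idPl _)// le_max invr_ge0 ler0n.
  + by rewrite (max_idPr _) ?(min_idPr _); lra.
  + move=> t /andP[t0 t1]; rewrite le_min le_max ge_min ge_max.
    by apply/andP; split; [apply/andP; split; [lra|apply/orP; left; lra]|
      apply/orP; right; apply/andP; split; lra].
  + by move/continuousP: ck; apply; exact: open_lt.
  + by apply: finite_image; exact: finite_finset.
  + move=> u j t t01 /=; rewrite kE// ltr_norml => /andP[h1 h2].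
    exists (u, j) => //=; congr (edge _ _ _).
    by rewrite (max_idPl _) ?(min_idPr _); lra.
  + by rewrite /=; lra.
Qed.

(** So [l] is the coboundary of [phi]: cut the path into short pieces. *)
Lemma path_exact (p : continuousType R Y) : l (spath p) = phi (p 1) - phi (p 0).
Proof.
pose Q (A : set R) := forall a b, (forall t, 0 <= t <= 1 -> A (a + t * (b - a))) ->
     l (spath (subpath p a b)) = phi (p b) - phi (p a).
have [||N eP] := @lebesgue_unit R Q.
- by move=> A B AB QB a b Aab; apply: QB => t t01; apply: AB; exact: Aab.
- by move=> x _; exact: local_exact.
have ind k : (k <= N.+1)%N -> l (spath (subpath p 0 (k%:R / N.+1%:R))) =
    phi (p (k%:R / N.+1%:R)) - phi (p 0).
  elim: k => [|k IH] kN; first by rewrite mul0r cocycle_subpath0// subrr.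
  rewrite (cocycle_subpath cl _ 0 (k%:R / N.+1%:R)) IH ?(ltnW kN)//.
  rewrite (eP (k%:R / N.+1%:R)) => [||t /andP[t0 t1]].
  - by rewrite addrC addrA subrK.
  - by apply: grid01; exact: ltnW.
  - rewrite /= opprD addrA subrr add0r normrN -mulrBl -natrB// subSnn mul1r.
    by rewrite ger0_norm ?mulr_ge0 ?invr_ge0 ?ler0n// ler_piMl// invr_ge0 ler0n.
have := ind N.+1 (leqnn _); rewrite divff ?pnatr_eq0// => <-.
by congr (l _); apply: eq_spath => t _; rewrite subpathE; congr (p _); ring.
Qed.

End Exact.

(** * Integration of local cocycles along paths *)

(** A function [d] of pairs of points that is additive on sufficiently small sets
    behaves like a closed 1-form: the sum of its values over a fine subdivision
    of a path does not depend on the subdivision. *)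
Section Integrate.
Context (R : realType) (Y : topologicalType) (M : zmodType).
Variable d : Y -> Y -> M.
Hypothesis dloc : forall y : Y, exists2 U : set Y, nbhs y U &
  forall a b c, U a -> U b -> U c -> d a b + d b c = d a c.

Lemma d_refl y : d y y = 0.
Proof.
have [U nU dU] := dloc y; have Uy := nbhs_singleton nU.
by apply: (@addrI _ (d y y)); rewrite addr0 dU.
Qed.

(** On a square a closed form is exact. The potential at a point is the integral
    along the segment from the origin; the segments to two close points span
    thin quadrilaterals, and their contributions telescope. *)
Lemma potential_exists (h : R * R -> Y) : continuous h ->
  exists (th : R * R -> M) (e : R), 0 < e /\
   forall a b, 0 <= a.1 <= 1 -> 0 <= a.2 <= 1 -> 0 <= b.1 <= 1 -> 0 <= b.2 <= 1 ->
    `|a.1 - b.1| < e -> `|a.2 - b.2| < e -> d (h a) (h b) = th b - th a.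
Proof.
move=> ch.
pose Q (A : set (R * R)) := forall x y z, A x -> A y -> A z ->
  d (h x) (h y) + d (h y) (h z) = d (h x) (h z).
have [|x _|e e0 eP] := @lebesgue_number R (R * R)%type _ Q (@unit_square_compact R).
- by move=> A B AB QB x y z Ax Ay Az; apply: QB; exact: AB.
- by have [U nU dU] := dloc (h x); exists (h @^-1` U);
    [exact: ch|move=> a b c; exact: dU].
have e2 : 0 < e / 2 by rewrite divr_gt0.
have [N' Ne] := exists_invn_lt e2; pose N := N'.+1.
have N0 : 0 < N%:R :> R by rewrite ltr0n.
pose sc (k : nat) (x : R * R) : R * R := (k%:R / N%:R * x.1, k%:R / N%:R * x.2).
pose th x := \sum_(0 <= k < N) d (h (sc k x)) (h (sc k.+1 x)).
exists th, (e / 2); split=> // a b a1 a2 b1 b2 ab1 ab2.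
have c01 k : (k <= N)%N -> 0 <= k%:R / N%:R :> R /\ k%:R / N%:R <= 1 :> R.
  by move=> kN; rewrite divr_ge0 ?ler0n// ler_pdivrMr// mul1r ler_nat.
have sc01 k (x : R) : (k <= N)%N -> 0 <= x <= 1 -> 0 <= k%:R / N%:R * x <= 1.
  move=> /c01[k0 k1] /andP[x0 x1]; rewrite mulr_ge0//=.
  by apply: le_trans x1; rewrite ler_piMl.
have near1 k (x y : R) : (k <= N)%N -> `|x - y| < e / 2 ->
    `|k%:R / N%:R * x - k%:R / N%:R * y| < e / 2.
  move=> /c01[k0 k1] xy; rewrite -mulrBr normrM ger0_norm//.
  by apply: le_lt_trans xy; rewrite ler_piMl.
have near2 k (x : R) : 0 <= x <= 1 ->
    `|k%:R / N%:R * x - k.+1%:R / N%:R * x| < e / 2.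
  move=> /andP[x0 x1]; rewrite -mulrBl -mulrBl -natr1 opprD addrA subrr add0r.
  rewrite mulN1r mulNr normrN normrM !ger0_norm ?invr_ge0 ?ler0n//.
  by apply: le_lt_trans Ne; rewrite ler_piMr// invr_ge0.
have step k : (k < N)%N ->
   d (h (sc k b)) (h (sc k.+1 b)) - d (h (sc k a)) (h (sc k.+1 a)) =
   d (h (sc k.+1 a)) (h (sc k.+1 b)) - d (h (sc k a)) (h (sc k b)).
  move=> kN; have kN' := ltnW kN.
  have {}eP : Q (ball (sc k a) e).
    by apply: eP; split; rewrite /= in_itv /=; exact: sc01.
  have B0 : ball (sc k a) e (sc k a) by exact: ballxx.
  have B1 : ball (sc k a) e (sc k b).
    by split; rewrite /ball /=; apply: (@lt_trans _ _ (e / 2));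
      [exact: near1|lra|exact: near1|lra].
  have B2 : ball (sc k a) e (sc k.+1 a).
    by split; rewrite /ball /=; apply: (@lt_trans _ _ (e / 2));
      [exact: near2|lra|exact: near2|lra].
  have B3 : ball (sc k a) e (sc k.+1 b).
    split; rewrite /ball /= [e]splitr.
      apply: le_lt_trans (ler_distD (k.+1%:R / N%:R * a.1) _ _) _.
      by apply: ltrD; [exact: near2|exact: near1].
    apply: le_lt_trans (ler_distD (k.+1%:R / N%:R * a.2) _ _) _.
    by apply: ltrD; [exact: near2|exact: near1].
  have := eP _ _ _ B0 B1 B3; rewrite -(eP _ _ _ B0 B2 B3) => E.
  apply/eqP; rewrite subr_eq addrAC eq_sym subr_eq; apply/eqP.
  by rewrite [RHS]addrC E addrC.
rewrite /th -sumrB (eq_big_nat _ _ (F2 := fun k => d (h (sc k.+1 a)) (h (sc k.+1 b))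
   - d (h (sc k a)) (h (sc k b)))); last by move=> k /andP[_]; exact: step.
rewrite telescope_sumr// /sc !mul0r d_refl subr0 divff ?gt_eqF// !mul1r.
by case: (a) (b) => ? ? [].
Qed.

Definition is_var (p : R -> Y) x := exists N0, forall N, (N0 <= N)%N ->
  \sum_(0 <= k < N) d (p (k%:R / N%:R)) (p (k.+1%:R / N%:R)) = x.

Lemma is_var_uniq p x y : is_var p x -> is_var p y -> x = y.
Proof.
move=> [N0 H0] [N1 H1].
by rewrite -(H0 (maxn N0 N1)) ?leq_maxl// H1 ?leq_maxr.
Qed.

Lemma is_var_ext (p q : R -> Y) x : (forall t, 0 <= t <= 1 -> p t = q t) ->
  is_var p x -> is_var q x.
Proof.
move=> e [N0 H0]; exists N0 => -[|N] NN0.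
  by rewrite big_nil -(H0 _ NN0) big_nil.
rewrite -(H0 _ NN0); apply: eq_big_nat => k /andP[_ kN].
by rewrite !e// divr_ge0 ?ler0n//= ler_pdivrMr ?ltr0n// mul1r ler_nat// ltnW.
Qed.

Lemma is_var_cst p y : (forall t, 0 <= t <= 1 -> p t = y) -> is_var p 0.
Proof.
move=> e; apply: (@is_var_ext (fun=> y)); first by move=> t /e ->.
by exists 0%N => N _; rewrite big1// => k _; rewrite d_refl.
Qed.

Lemma potential_var (h : R * R -> Y) th (e : R) (A B : R * R) (p : R -> Y) :
  0 < e ->
  (forall a b, 0 <= a.1 <= 1 -> 0 <= a.2 <= 1 -> 0 <= b.1 <= 1 -> 0 <= b.2 <= 1 ->
    `|a.1 - b.1| < e -> `|a.2 - b.2| < e -> d (h a) (h b) = th b - th a) ->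
  0 <= A.1 <= 1 -> 0 <= A.2 <= 1 -> 0 <= B.1 <= 1 -> 0 <= B.2 <= 1 ->
  (forall t, 0 <= t <= 1 -> p t = seg h A B t) ->
  is_var p (th B - th A).
Proof.
move=> e0 eP A1 A2 B1 B2 ep; apply: is_var_ext (fun t tP => esym (ep t tP)) _.
have [N1 N1e] := exists_invn_lt e0; exists N1.+1 => N NN.
have N0 : 0 < N%:R :> R by rewrite ltr0n; exact: leq_trans NN.
have Ne : N%:R^-1 < e.
  apply: le_lt_trans N1e; have N1p : 0 < N1.+1%:R :> R by rewrite ltr0n.
  by rewrite (lef_pV2 N0 N1p) ler_nat.
pose pt (k : nat) : R * R := (A.1 + k%:R / N%:R * (B.1 - A.1), A.2 + k%:R / N%:R * (B.2 - A.2)).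
have c01 k : (k <= N)%N -> 0 <= k%:R / N%:R :> R /\ k%:R / N%:R <= 1 :> R.
  by move=> kN; rewrite divr_ge0 ?ler0n// ler_pdivrMr// mul1r ler_nat.
have p01 (x y : R) k : (k <= N)%N -> 0 <= x <= 1 -> 0 <= y <= 1 ->
    0 <= x + k%:R / N%:R * (y - x) <= 1.
  move=> /c01[]; set t := _ / _ => t0 t1 /andP[x0 x1] /andP[y0 y1].
  by apply/andP; split; nra.
have dist (x y : R) k : 0 <= x <= 1 -> 0 <= y <= 1 ->
   `|x + k%:R / N%:R * (y - x) - (x + k.+1%:R / N%:R * (y - x))| < e.
  move=> /andP[x0 x1] /andP[y0 y1].
  rewrite (_ : _ - _ = N%:R^-1 * (x - y)); last first.
    by rewrite -natr1; field; rewrite gt_eqF.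
  rewrite normrM ger0_norm ?invr_ge0 ?ler0n//; apply: le_lt_trans Ne.
  by rewrite ler_piMr ?invr_ge0 ?ler0n// ler_norml; apply/andP; split; lra.
rewrite (eq_big_nat _ _ (F2 := fun k => th (pt k.+1) - th (pt k))); last first.
  by move=> k /andP[_ kN]; rewrite /seg eP//=; (try apply: p01 => //; try exact: ltnW);
    exact: dist.
rewrite telescope_sumr// /pt !mul0r !addr0 divff ?gt_eqF// !mul1r !addrA.
by rewrite [A.1 + _]addrC [A.2 + _]addrC !addrK; case: (A) (B) => ? ? [].
Qed.

Lemma is_var_exists (p : continuousType R Y) : exists x, is_var p x.
Proof.
have ch : continuous (fun x : R * R => p x.1).
  by apply: cont_comp (@cts_fun _ _ p); rcont.
have [th [e [e0 eP]]] := potential_exists ch.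
exists (th (1, 0) - th (0, 0)).
apply: (potential_var e0 eP); rewrite /= ?lexx ?ler01// => t _.
by rewrite /seg /= subr0 mulr1 add0r.
Qed.

Definition integral (s : singular_simplex R 1 Y) : M :=
  sval (cid (is_var_exists (path_of s))).

Lemma integralE (p : continuousType R Y) x : is_var p x -> integral (spath p) = x.
Proof.
rewrite /integral; case: cid => y /= vy vx; apply: is_var_uniq vy _.
apply: is_var_ext vx => t t01; rewrite /= /mkcts coef_pt1 /interval_weight /=.
by rewrite clampK.
Qed.

(** The potential on the square that parametrises a singular triangle; its
    collapsed side is a constant path. *)
Lemma integral_cocycle : cocycle integral.
Proof.
move=> s.
have ch : continuous (fun x : R * R => s (pt2 x)).
  by apply: cont_comp (@pt2_cont R) _; exact: cts_fun.
have [th [e [e0 eP]]] := potential_exists ch.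
have pv := potential_var e0 eP.
have i0 := in01_0 R.
have i1 := in01_1 R.
rewrite -[X in integral X = _]path_ofK -[X in _ = integral X + _]path_ofK.
rewrite -[X in _ = _ + integral X]path_ofK.
have th0 : th (0, 1) = th (0, 0).
  apply/eqP; rewrite -subr_eq0; apply/eqP.
  apply: (@is_var_uniq (fun t => s (pt2 (0, t)))).
    apply: (pv (0, 0) (0, 1)) => //= t t01; rewrite /seg /=.
    by congr (s (pt2 (_, _))); ring.
  apply: (@is_var_cst _ (s (pt2 (0, 0)))) => t t01; congr (s _).
  apply: simplex_eq => j; rewrite !coef_pt2 /square_weight /= clamp0.
  by case: (ord3P j) => -> /=; rewrite ?mul0r.
have pt1E t : 0 <= t <= 1 -> coef o0 (@pt1 R t) = 1 - t /\ coef o1 (@pt1 R t) = t.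
  by move=> t01; rewrite !coef_pt1 /interval_weight /= clampK.
rewrite (@integralE _ (th (1, 1) - th (0, 1))); last first.
  apply: (pv (0, 1) (1, 1)) => //= t t01; rewrite /mkcts /seg /= subrr mulr0 addr0.
  rewrite subr0 mulr1 add0r; congr (s _); apply: simplex_eq => j.
  rewrite coef_pt2 /square_weight /= clamp1 clampK//.
  have [? ?] := pt1E _ t01; have [? ? ?] := coef_face1 (pt1 t).
  by case: (ord3P j) => -> /=; lra.
rewrite (@integralE _ (th (1, 0) - th (0, 0))); last first.
  apply: (pv (0, 0) (1, 0)) => //= t t01; rewrite /mkcts /seg /= subrr mulr0 addr0.
  rewrite subr0 mulr1 add0r; congr (s _); apply: simplex_eq => j.
  rewrite coef_pt2 /square_weight /= clamp0 clampK//.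
  have [? ?] := pt1E _ t01; have [? ? ?] := coef_face2 (pt1 t).
  by case: (ord3P j) => -> /=; lra.
rewrite (@integralE _ (th (1, 1) - th (1, 0))); last first.
  apply: (pv (1, 0) (1, 1)) => //= t t01; rewrite /mkcts /seg /= subrr mulr0 addr0.
  rewrite subr0 mulr1 add0r; congr (s _); apply: simplex_eq => j.
  rewrite coef_pt2 /square_weight /= clamp1 clampK//.
  have [? ?] := pt1E _ t01; have [? ? ?] := coef_face0 (pt1 t).
  by case: (ord3P j) => -> /=; lra.
by rewrite th0 [RHS]addrC addrA subrK.
Qed.

End Integrate.

(** * The cocycle dual to an edge *)

Section EdgeCocycle.
Context (R : realType) (Y : topologicalType) (T : finType) (n : nat).
Variable (G : graph R Y T n).
Local Notation edge := (edge G).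
Local Notation vt := (vt G).
Local Notation sig := (sig G).

Lemma closed_arc u j a b : closed (edge u j @` `[a, b]).
Proof.
apply: compact_closed; first exact: (graph_hausdorff G).
apply: continuous_compact; last exact: segment_compact.
exact: continuous_subspaceT (@edge_cont _ _ _ _ G u j).
Qed.

Lemma edge_int u j t u' j' t' : 0 < t < 1 -> 0 <= t' <= 1 ->
  edge u j t = edge u' j' t' -> [/\ u' = u, j' = j & t' = t].
Proof.
move=> t0 /le01P[->|->|t'0].
- by rewrite edge0 => /edge_vt; case.
- by rewrite edge1 => /edge_vt; case.
- by move=> /edge_inj; case=> // -> -> ->.
Qed.

Variables (u0 : T) (j0 : 'I_n).

(** [crossing a b] counts the signed passages from [a] to [b] over the end of the
    edge [(u0, j0)]: it is nonzero only if one of the points lies in the last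
    third of the edge, and the other one neither there nor in the middle
    third. *)
Definition late y : rat :=
  (`[< exists t, 2 / 3 < t < 1 /\ edge u0 j0 t = y >])%:R.
Definition early y : rat :=
  (~~ `[< exists t, 1 / 3 <= t < 1 /\ edge u0 j0 t = y >])%:R.
Definition crossing a b : rat := late a * early b - early a * late b.

Lemma late_early y : late y = 1 -> early y = 0.
Proof.
rewrite /late /early; case: asboolP => // -[t [/andP[t0 t1] <-]] _.
rewrite (_ : `[< _ >] = true)//; apply/asboolP; exists t; split=> //.
by apply/andP; split; lra.
Qed.

Lemma late01 y : late y = 0 \/ late y = 1.
Proof. by rewrite /late; case: asboolP; auto. Qed.

Lemma late_middle y : ~ (edge u0 j0 @` `[1/3, 2/3]) y -> early y = 1 - late y.
Proof.
move=> ny; case: (late01 y) => ly; last by rewrite late_early// ly subrr.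
rewrite ly subr0 /early; case: asboolP => // -[t [/andP[t0 t1] e]].
move: ly; rewrite /late; case: asboolP => // nl _; exfalso.
have [t2|t2] := ltP (2/3) t; first by apply: nl; exists t; rewrite t2.
by apply: ny; exists t => //; rewrite /= in_itv /= t0 t2.
Qed.

(** Three open sets are enough: outside the middle third [crossing] is the
    difference of the values of [late], and it vanishes both outside the last
    third and in the part of the edge after the first third. *)
Lemma crossing_local (y : Y) : exists2 U : set Y, nbhs y U &
  forall a b c, U a -> U b -> U c -> crossing a b + crossing b c = crossing a c.
Proof.
have nC (C : set Y) : closed C -> ~ C y -> nbhs y (~` C).
  by move=> cC nCy; apply: open_nbhs_nbhs; split=> //; exact: closed_openC.
have [y1|y1] := pselect ((edge u0 j0 @` `[1/3, 2/3]) y); last first.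
  exists (~` (edge u0 j0 @` `[1/3, 2/3])); first exact: nC (@closed_arc _ _ _ _) y1.
  move=> a b c /late_middle ea /late_middle eb /late_middle ec.
  by rewrite /crossing ea eb ec; ring.
have [y2|y2] := pselect ((edge u0 j0 @` `[2/3, 1]) y); last first.
  exists (~` (edge u0 j0 @` `[2/3, 1])); first exact: nC (@closed_arc _ _ _ _) y2.
  have lz a : ~ (edge u0 j0 @` `[2/3, 1]) a -> late a = 0.
    move=> na; rewrite /late; case: asboolP => // -[t [/andP[t0 t1] e]].
    by exfalso; apply: na; exists t => //; rewrite /= in_itv /=; apply/andP; split; lra.
  move=> a b c /lz ea /lz eb /lz ec; rewrite /crossing ea eb ec; ring.
have ey : edge u0 j0 (2/3) = y.
  case: y1 => t; rewrite /= in_itv /= => /andP[t0 t1] e.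
  case: y2 => t'; rewrite /= in_itv /= => /andP[t'0 t'1] e'.
  have [|||_ _ tt] := @edge_int u0 j0 t u0 j0 t'; rewrite ?e ?e'//.
  - by apply/andP; split; lra.
  - by apply/andP; split; lra.
  - by rewrite -e; congr (edge _ _ _); lra.
pose C := (\bigcup_(x in [set x : T * 'I_n | x != (u0, j0)]) (edge x.1 x.2 @` `[0, 1]))
   `|` (edge u0 j0 @` `[0, 1/3] `|` edge u0 j0 @` `[1, 1]).
exists (~` C).
  apply: nC.
    apply: closedU; last by apply: closedU; exact: closed_arc.
    by apply: closed_bigcup => [|x _]; [exact: finite_finset|exact: closed_arc].
  have i23 : 0 < (2/3 : R) < 1 by apply/andP; split; lra.
  rewrite -ey => -[[[u j] /= /eqP uj]|[]] [t]; rewrite /= in_itv /= => /andP[t0 t1].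
  - have t01 : 0 <= t <= 1 by rewrite t0.
    by move=> /esym /(edge_int i23 t01)[ua ja _]; apply: uj; rewrite ua ja.
  - have t01 : 0 <= t <= 1 by apply/andP; split; lra.
    by move=> /esym /(edge_int i23 t01)[_ _ tt]; clear ey; lra.
  - have t01 : 0 <= t <= 1 by apply/andP; split; lra.
    by move=> /esym /(edge_int i23 t01)[_ _ tt]; clear ey; lra.
have ez a : ~ C a -> early a = 0.
  move=> na; rewrite /early; case: asboolP => // nh; exfalso; apply: na.
  have [u [j [t [/andP[t0 t1] e]]]] := edge_sur G a.
  have [[ua ja]|/eqP uj] := (u, j) =P (u0, j0); last first.
    by left; exists (u, j) => //; exists t => //; rewrite /= in_itv /= t0.
  rewrite ua ja in e; right.
  have [t3|t3] := leP t (1/3); first by left; exists t => //; rewrite /= in_itv /= t0.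
  right; exists t => //; rewrite /= in_itv /= t1 andbT leNgt; apply/negP => t1'.
  by apply: nh; exists t; rewrite t1' (ltW t3).
by move=> a b c /ez ea /ez eb /ez ec; rewrite /crossing ea eb ec; ring.
Qed.

Lemma lateE u j t : 0 <= t <= 1 ->
  late (edge u j t) = ((u == u0) && (j == j0) && (2/3 < t < 1))%:R.
Proof.
move=> t01; rewrite /late; congr (nat_of_bool _)%:R; apply/asboolP/idP.
  move=> [t' [/andP[t0 t1] e]].
  have t'01 : 0 < t' < 1 by apply/andP; split; lra.
  have [-> -> ->] := edge_int t'01 t01 e.
  by rewrite !eqxx t0.
by move=> /andP[/andP[/eqP-> /eqP->] h]; exists t.
Qed.

Lemma earlyE u j t : 0 <= t <= 1 ->
  early (edge u j t) = (~~ ((u == u0) && (j == j0) && (1/3 <= t < 1)))%:R.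
Proof.
move=> t01; rewrite /early; congr (nat_of_bool (~~ _))%:R; apply/asboolP/idP.
  move=> [t' [/andP[t0 t1] e]].
  have t'01 : 0 < t' < 1 by apply/andP; split; lra.
  have [-> -> ->] := edge_int t'01 t01 e.
  by rewrite !eqxx t0.
by move=> /andP[/andP[/eqP-> /eqP->] h]; exists t.
Qed.

(** Along the edge itself only the last step of a subdivision is a crossing. *)
Lemma edge_cocycle : exists2 l : singular_simplex R 1 Y -> rat, cocycle l &
  forall u j, l (spath (edgep G u j)) = ((u == u0) && (j == j0))%:R.
Proof.
exists (integral crossing_local); first exact: integral_cocycle.
move=> u j; apply: integralE.
have [/andP[/eqP-> /eqP->]|/negPf uj] := boolP ((u == u0) && (j == j0)); last first.
  exists 1%N => -[//|N] _; rewrite big1_seq// => k; rewrite mem_index_iota => /andP[_ /andP[_ kN]].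
  have kt i : (i <= N.+1)%N -> 0 <= (i%:R / N.+1%:R : R) <= 1.
    by move=> iN; rewrite divr_ge0 ?ler0n//= ler_pdivrMr ?ltr0n// mul1r ler_nat.
  by rewrite /= /mkcts /crossing !lateE ?uj ?mul0r ?mulr0 ?subrr// kt// ltnW.
exists 4%N => -[//|N] N4.
have N0 : 0 < N.+1%:R :> R by rewrite ltr0n.
have N4' : 4 <= N.+1%:R :> R by rewrite (ler_nat _ 4).
have kt i : (i <= N.+1)%N -> 0 <= (i%:R / N.+1%:R : R) <= 1.
  by move=> iN; rewrite divr_ge0 ?ler0n//= ler_pdivrMr ?ltr0n// mul1r ler_nat.
rewrite big_nat_recr//= big1_seq ?add0r => [|k]; last first.
  rewrite mem_index_iota => /andP[_ /andP[_ kN]].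
  have kN1 : (k <= N.+1)%N by rewrite ltnW // ltnW.
  have kN2 : (k < N.+1)%N by exact: leqW.
  have k1 : k.+1%:R / N.+1%:R < 1 :> R by rewrite ltr_pdivrMr// mul1r ltr_nat.
  rewrite /mkcts /crossing !lateE ?earlyE ?kt//.
  rewrite !eqxx /= k1.
  have kk : k.+1%:R / N.+1%:R = k%:R / N.+1%:R + N.+1%:R^-1 :> R.
    by rewrite -natr1 mulrDl mul1r.
  have Ni : N.+1%:R^-1 <= 4^-1 :> R by rewrite lef_pV2 ?posrE.
  have Ni0 : 0 < N.+1%:R^-1 :> R by rewrite invr_gt0.
  rewrite kk; set x := k%:R / _; set i := _^-1 in Ni Ni0 *.
  have k1' : x < 1 by move: k1; rewrite kk -/x -/i; lra.
  rewrite k1' !andbT.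
  have [h1|h1] := ltP (2/3) x; have [h2|h2] := ltP (2/3) (x + i);
   have [h3|h3] := leP (1/3) x; have [h4|h4] := leP (1/3) (x + i) => /=;
   rewrite ?mulr0 ?mul0r ?subrr//; exfalso; lra.
rewrite /mkcts divff ?gt_eqF// /crossing !lateE ?earlyE ?kt ?ler01 ?lexx//.
rewrite !eqxx /= ltxx !andbF /= mulr1 mulr0 subr0.
have NN : N%:R / N.+1%:R = 1 - N.+1%:R^-1 :> R.
  by rewrite -[N.+1%:R in X in _ = X]natr1 -[in LHS]natr1; field; rewrite natr1 gt_eqF.
have Ni : N.+1%:R^-1 <= 4^-1 :> R by rewrite lef_pV2 ?posrE.
have Ni0 : 0 < N.+1%:R^-1 :> R by rewrite invr_gt0.
rewrite NN; set i := _^-1 in Ni Ni0 *.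
by rewrite (_ : (_ < _) && _ = true)//; apply/andP; split; lra.
Qed.

End EdgeCocycle.

(** * Words acting on the vertices, and Fox calculus *)

Section Words.
Context (T : finType) (n : nat) (sig : 'I_n -> {perm T}).

(** A letter is a generator with an exponent, [true] for 1 and [false] for -1. A
    word acts on [T] from the right, letter by letter; this agrees with the
    product of permutations. *)
Definition word := seq ('I_n * bool).
Implicit Types (w : word) (l : 'I_n * bool).

Definition lact l : {perm T} := if l.2 then sig l.1 else (sig l.1)^-1%g.

Fixpoint wact w : {perm T} := if w is l :: w' then (lact l * wact w')%g else 1%g.

(** The signed number of passages through the edge [(x, j)] of the letter [l]
    started at [u]. A negative letter runs through the edge that starts at its
    own end point. *)
Definition lcount u l (x : T) (j : 'I_n) : rat :=
  if l.2 then ((u == x) && (l.1 == j))%:R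
  else - ((lact l u == x) && (l.1 == j))%:R.

Fixpoint wcount u w x j : rat :=
  if w is l :: w' then lcount u l x j + wcount (lact l u) w' x j else 0.

Lemma wact_cat w w' : wact (w ++ w') = (wact w * wact w')%g.
Proof. by elim: w => [|l w IH] /=; rewrite ?mul1g// IH mulgA. Qed.

Lemma wcount_cat u w w' x j :
  wcount u (w ++ w') x j = wcount u w x j + wcount (wact w u) w' x j.
Proof.
elim: w u => [|l w IH] u /=; first by rewrite perm1 add0r.
by rewrite IH permM addrA.
Qed.

Definition linv l := (l.1, ~~ l.2).
Definition winv w : word := rev (map linv w).

Lemma lact_inv l : lact (linv l) = (lact l)^-1%g.
Proof. by case: l => j []; rewrite /lact //= invgK. Qed.

Lemma winv_cons l w : winv (l :: w) = winv w ++ [:: linv l].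
Proof. by rewrite /winv /= rev_cons cats1. Qed.

Lemma wact_inv w : wact (winv w) = (wact w)^-1%g.
Proof.
elim: w => [|l w IH] /=; first by rewrite invg1.
by rewrite winv_cons wact_cat IH /= mulg1 lact_inv invMg.
Qed.

Lemma wcount_inv w u x j : wcount (wact w u) (winv w) x j = - wcount u w x j.
Proof.
elim: w u => [|l w IH] u /=; first by rewrite oppr0.
rewrite winv_cons wcount_cat permM IH wact_inv -permM mulgV perm1 /= addr0 opprD addrC.
congr (_ + _); case: l => i [] /=; rewrite /lcount /= /lact /=.
  by rewrite permK.
by rewrite opprK.
Qed.

Definition avoid (i : 'I_n) w := all (fun l => l.1 != i) w.

Lemma avoid_inv i w : avoid i (winv w) = avoid i w.
Proof. by rewrite /avoid all_rev all_map. Qed.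

Lemma avoid_cat i w w' : avoid i (w ++ w') = avoid i w && avoid i w'.
Proof. exact: all_cat. Qed.

Section Kill.
Variable i : 'I_n.

(** The chain obtained by starting the word [w] at all vertices, with weights
    [a]. *)
Definition wsum (a : T -> rat) w x j : rat := \sum_u a u * wcount u w x j.

(** For a regular cover, with [T] identified with the deck group: [a] annihilates,
    in the group ring, the classes of the closed words without the letter [i]. *)
Definition killed (a : T -> rat) := forall w x j, avoid i w -> wact w = 1%g ->
  wsum a w x j = 0.

Lemma wsum_cat a w w' x j :
  wsum a (w ++ w') x j = wsum a w x j + wsum (fun u => a ((wact w)^-1%g u)) w' x j.
Proof.
rewrite /wsum [X in _ = _ + X](reindex_inj (@perm_inj _ (wact w))) -big_split.
by apply: eq_bigr => u _ /=; rewrite wcount_cat mulrDr permK.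
Qed.

Lemma wsum_inv a w x j :
  wsum (fun u => a ((wact w)^-1%g u)) (winv w) x j = - wsum a w x j.
Proof.
rewrite /wsum [LHS](reindex_inj (@perm_inj _ (wact w))) -sumrN.
by apply: eq_bigr => u _ /=; rewrite permK wcount_inv mulrN.
Qed.

(** For such [a] the chain of a word depends only on its permutation: two words
    with the same permutation differ by a closed word. *)
Lemma killed_eq a w w' x j : killed a -> avoid i w -> avoid i w' ->
  wact w = wact w' -> wsum a w x j = wsum a w' x j.
Proof.
move=> ka aw aw' e; apply/eqP; rewrite -subr_eq0 -(wsum_inv a w') -e -wsum_cat.
by apply/eqP/ka; rewrite ?avoid_cat ?avoid_inv ?aw// wact_cat wact_inv e mulgV.
Qed.

(** Conjugates of closed words are closed. *)
Lemma killed_shift a w : killed a -> avoid i w ->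
  killed (fun u => a ((wact w)^-1%g u)).
Proof.
move=> ka aw w' x j aw' w'1.
have : wsum a (w ++ w' ++ winv w) x j = 0.
  by apply: ka; rewrite ?avoid_cat ?avoid_inv ?aw ?aw'// !wact_cat wact_inv w'1 mul1g mulgV.
rewrite !wsum_cat w'1 invg1.
under [X in _ + (_ + X)]eq_bigr do rewrite perm1.
by rewrite -/(wsum _ _ _ _) wsum_inv addrC addrNK.
Qed.

Definition realised (h : {perm T}) := `[< exists w, avoid i w /\ wact w = h >].

Lemma realisedP h : realised h -> {w | avoid i w /\ wact w = h}.
Proof. by move=> /asboolP /cid. Qed.

Definition wrep (h : {perm T}) : word :=
  if pselect (realised h) is left r then sval (realisedP r) else [::].

Lemma wrepP h : realised h -> avoid i (wrep h) /\ wact (wrep h) = h.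
Proof. by rewrite /wrep; case: pselect => // r _; exact: (svalP (realisedP r)). Qed.

(** By [killed_eq] the coefficients at the letter [j] of the chains of words
    define a crossed homomorphism on the finite group of realised permutations.
    Crossed homomorphisms on finite groups are principal, and the primitive is
    given by this sum over the group, up to the order of the group. *)
Definition avg (j : 'I_n) (a : T -> rat) (x : T) : rat :=
  \sum_(h | realised h) wsum a (wrep h) x j.

(** The sum is reindexed by left multiplication with the letter. *)
Lemma avg_shift j a l x : l.1 != i -> killed a ->
  avg j (fun u => a ((lact l)^-1%g u)) x =
  avg j a x - #|[pred h | realised h]|%:R * wsum a [:: l] x j.
Proof.
move=> li ka; rewrite /avg.
have al : avoid i [:: l] by rewrite /avoid /= li.
have rl h : realised (lact l * h)%g = realised h.
  apply/asboolP/asboolP => -[w [aw wh]].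
    exists (linv l :: w); split; first by rewrite /avoid /= li.
    by rewrite /= wh lact_inv mulKg.
  by exists (l :: w); split; [rewrite /avoid /= li|rewrite /= wh].
rewrite [in RHS](reindex_inj (mulgI (lact l))) /=.
rewrite (eq_bigl _ _ rl).
apply/eqP; rewrite -subr_eq opprK addrC eq_sym; apply/eqP.
rewrite -sum1_card natr_sum mulr_suml /= -big_split /=.
apply: eq_bigr => h rh; rewrite mul1r.
have [arep wr] := wrepP rh.
have rlh : realised (lact l * h)%g by rewrite rl.
have [arep' wr'] := wrepP rlh.
rewrite (@killed_eq a (wrep (lact l * h)%g) ([:: l] ++ wrep h)) //.
- by rewrite wsum_cat /= mulg1.
- by rewrite avoid_cat al.
- by rewrite wr' wact_cat wr /= mulg1.
Qed.

Lemma wsum1 a j k x : wsum a [:: (j, true)] x k = a x * (j == k)%:R.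
Proof.
rewrite /wsum (bigD1 x)//= big1 ?addr0.
  by rewrite /lcount /= eqxx ?addr0.
by move=> u /negPf ux; rewrite /lcount /= ux addr0 mulr0.
Qed.

(** Let Y and Z be the actions of two letters [y] and [z] on functions on the
    vertices, and P, Q the averages in the directions [y] and [z] divided by the
    order of the group. By [avg_shift], P (1 - Y) and Q (1 - Z) are the
    identity, and Q Y = Q. If N is the sum of the powers of Y, then
    (1 - Y) N = 0 and thus N = P (1 - Y) N = 0; but Q N is a positive multiple
    of Q. So Q = 0, and the identity is zero on the annihilated functions. *)
Lemma killed0 (y z : 'I_n) a : y != i -> z != i -> y != z -> killed a ->
  forall x, a x = 0.
Proof.
move=> yi zi yz ka x.
pose H := #|[pred h | realised h]|%:R : rat.
have H0 : H != 0.
  rewrite pnatr_eq0 -lt0n; apply/card_gt0P; exists 1%g; apply/asboolP.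
  by exists [::].
pose ry (b : T -> rat) := fun u => b ((sig y)^-1%g u).
pose rz (b : T -> rat) := fun u => b ((sig z)^-1%g u).
have ky b : killed b -> killed (ry b).
  by move=> /(@killed_shift b [:: (y, true)]); rewrite /avoid /= yi /= mulg1; exact.
have Ay b j v : killed b -> avg j (ry b) v = avg j b v - H * (b v * (y == j)%:R).
  by move=> kb; rewrite (@avg_shift j b (y, true)) ?wsum1.
have Az b j v : killed b -> avg j (rz b) v = avg j b v - H * (b v * (z == j)%:R).
  by move=> kb; rewrite (@avg_shift j b (z, true)) ?wsum1.
have ksum (b : nat -> T -> rat) N : (forall k, killed (b k)) ->
    killed (fun u => \sum_(k < N) b k u).
  move=> kb w v j aw w1; rewrite /wsum.
  under eq_bigr do rewrite mulr_suml.
  by rewrite exchange_big big1// => k _; exact: kb.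
have avgsum (b : nat -> T -> rat) N j v :
    avg j (fun u => \sum_(k < N) b k u) v = \sum_(k < N) avg j (b k) v.
  rewrite /avg [RHS]exchange_big; apply: eq_bigr => h _; rewrite /wsum.
  by rewrite exchange_big; apply: eq_bigr => u _; rewrite mulr_suml.
pose m := #[sig y]%g.
have kz a' : killed a' -> forall v, avg z a' v = 0.
  move=> {x}ka' v.
  pose b k := iter k ry a'.
  have kb k : killed (b k) by elim: k => [|k IH] //=; exact: ky.
  have bE k u : b k u = a' (((sig y) ^+ k)^-1%g u).
    elim: k u => [|k IH] u; first by rewrite expg0 invg1 perm1.
    by rewrite /b /= -/(b k) /ry IH -permM -invMg expgSr.
  have bm u : b m u = a' u by rewrite bE expg_order invg1 perm1.
  pose Na u := \sum_(k < m) b k u.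
  have kNa : killed Na by exact: ksum.
  have ryNa u : ry Na u = Na u.
    rewrite /ry /Na; apply/eqP; rewrite -subr_eq0 -sumrB.
    rewrite -(big_mkord xpredT (fun k => b k ((sig y)^-1%g u) - b k u)).
    rewrite (eq_bigr (fun k => b k.+1 u - b k u)) => [|k _]; last by [].
    by rewrite telescope_sumr// bm subrr.
  have Na0 u : Na u = 0.
    have := Ay Na y u kNa; rewrite eqxx mulr1.
    rewrite (_ : ry Na = Na); last by apply/funext.
    move/eqP; rewrite -subr_eq0 opprB addrC addrNK mulf_eq0 (negPf H0) /=.
    by move/eqP.
  have avgz0 : m%:R * avg z a' v = 0.
    transitivity (avg z Na v); last first.
      rewrite /avg big1// => h _; rewrite /wsum big1// => u _.
      by rewrite Na0 mul0r.
    rewrite /Na avgsum (eq_bigr (fun _ => avg z a' v)).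
      by rewrite sumr_const card_ord mulr_natl.
    move=> k _; elim: (val k) => [|k' IH] //.
    by rewrite /b iterS -/(b k') Ay// (negPf yz) mulr0 mulr0 subr0.
  have m0 : m%:R != 0 :> rat by rewrite pnatr_eq0 -lt0n order_gt0.
  by apply/eqP; have /eqP := avgz0; rewrite mulf_eq0 (negPf m0).
have krz : killed (rz a).
  have := @killed_shift a [:: (z, true)] ka; rewrite /avoid /= zi /= mulg1; exact.
have /esym/eqP := Az a z x ka; rewrite eqxx mulr1 !kz// sub0r oppr_eq0.
by rewrite mulf_eq0 (negPf H0) => /eqP.
Qed.

End Kill.

(** What the transvection adds to a chain: every passage through an edge [(u, i)]
    is followed by the loop spelled by [w]. *)
Definition twist (i : 'I_n) w (k : T -> 'I_n -> rat) x j : rat :=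
  \sum_u k u i * wcount (sig i u) w x j.

(** Here the rank has to be at least three: two letters other than [j0] are
    needed. *)
Lemma twist_exists (k : T -> 'I_n -> rat) u0 j0 : (3 <= n)%N -> k u0 j0 != 0 ->
  exists i w, [/\ avoid i w, wact w = 1%g & exists x j, twist i w k x j != 0].
Proof.
move=> n3 k0.
have [y [z [yi zi yz]]] : exists y z : 'I_n, [/\ y != j0, z != j0 & y != z].
  have : (1 < #|[set~ j0]%SET|)%N by rewrite cardsC1 card_ord; case: (n) n3 => [|[|[|]]].
  by move=> /card_gt1P[y [z [+ + yz]]]; rewrite !inE => yi zi; exists y, z.
apply: contrapT => no.
pose a u := k ((sig j0)^-1%g u) j0.
have : a (sig j0 u0) = 0.
  apply: (@killed0 j0 y z) => // w x j aw w1.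
  apply/eqP; apply/negPn/negP => nz; apply: no; exists j0, w; split=> //.
  exists x, j; apply: contraNN nz => /eqP <-; apply/eqP.
  rewrite /wsum (reindex_inj (@perm_inj _ (sig j0))).
  by apply: eq_bigr => u _; rewrite /a permK.
by rewrite /a permK => /eqP; apply/negP.
Qed.

Lemma wcount_avoid u w x i : avoid i w -> wcount u w x i = 0.
Proof.
elim: w u => [|l w IH] u //= /andP[/negPf li aw].
by rewrite IH// /lcount li !andbF oppr0 if_same addr0.
Qed.

Lemma twist_avoid i w k x : avoid i w -> twist i w k x i = 0.
Proof. by move=> aw; rewrite /twist big1// => u _; rewrite wcount_avoid ?mulr0. Qed.

Definition wpow w d := flatten (nseq d w).

Lemma wpow_act w d : wact w = 1%g -> wact (wpow w d) = 1%g.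
Proof. by move=> w1; elim: d => [|d IH] //=; rewrite wact_cat w1 IH mul1g. Qed.

Lemma wpow_avoid i w d : avoid i w -> avoid i (wpow w d).
Proof. by move=> aw; elim: d => [|d IH] //=; rewrite avoid_cat aw IH. Qed.

Lemma wpow_count u w d x j : wact w = 1%g ->
  wcount u (wpow w d) x j = d%:R * wcount u w x j.
Proof.
move=> w1; elim: d => [|d IH] /=; first by rewrite mul0r.
by rewrite wcount_cat w1 perm1 IH -nat1r mulrDl mul1r.
Qed.

Lemma twist_wpow i w d k x j : wact w = 1%g ->
  twist i (wpow w d) k x j = d%:R * twist i w k x j.
Proof.
move=> w1; rewrite /twist mulr_sumr; apply: eq_bigr => u _.
by rewrite wpow_count// mulrCA.
Qed.

End Words.

(** * Quotients of abelian groups by subgroups given as propositions *)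

Section Quot.
Variables (V : zmodType) (S : V -> Prop).
Hypothesis S0 : S 0.
Hypothesis SB : forall x y, S x -> S y -> S (x - y).

Lemma quotient_exists : exists (M : zmodType) (p : V -> M),
  {morph p : x y / x + y} /\ (forall x, p x = 0 <-> S x).
Proof.
pose P : {pred V} := fun x => `[< S x >].
have zc : zmod_closed P.
  split; first exact/asboolP.
  by move=> x y /asboolP Sx /asboolP Sy; apply/asboolP; exact: SB.
pose K : zmodClosed V := HB.pack P (GRing.isZmodClosed.Build V P zc).
exists (Quotient.quot K), (\pi_(Quotient.quot K))%qT; split.
  by move=> x y; rewrite [RHS]piE.
move=> x; rewrite -[x in S x]subr0.
have -> : (0 : Quotient.quot K) = (\pi_(Quotient.quot K) 0)%qT by rewrite piE.
split=> [/eqP|Sx]; last apply/eqP.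
  by rewrite -Quotient.idealrBE => /asboolP.
by rewrite -Quotient.idealrBE; apply/asboolP.
Qed.
End Quot.

(** * Paths spelled by words, and their classes *)

Section WordPaths.
Context (R : realType) (Y : topologicalType) (T : finType) (n : nat).
Variable (G : graph R Y T n).
Local Notation edge := (edge G).
Local Notation vt := (vt G).
Local Notation sig := (sig G).
Local Notation word := (word n).
Local Notation lact := (lact sig).
Local Notation wact := (wact sig).
Local Notation wcount := (wcount sig).

Definition lpath (u : T) (l : 'I_n * bool) : R -> Y :=
  if l.2 then edge u l.1 else revp (edge ((sig l.1)^-1%g u) l.1).

Fixpoint wpath (u : T) (w : word) : R -> Y :=
  if w is l :: w' then pcat (lpath u l) (wpath (lact l u) w') else fun=> vt u.

Lemma lpath0 u l : lpath u l 0 = vt u.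
Proof. by case: l => j [] /=; rewrite /lpath /= ?edge0// /revp subr0 edge1 permKV. Qed.

Lemma lpath1 u l : lpath u l 1 = vt (lact l u).
Proof. by case: l => j [] /=; rewrite /lpath /= ?edge1// /revp subrr edge0. Qed.

Lemma lpath_cont u l : continuous (lpath u l).
Proof.
case: l => j [] /=; rewrite /lpath /=; first exact: edge_cont.
by apply: revp_cont; exact: edge_cont.
Qed.

Lemma wpath0 u w : wpath u w 0 = vt u.
Proof. by case: w => [|l w] //=; rewrite pcat0 lpath0. Qed.

Lemma wpath1 u w : wpath u w 1 = vt (wact w u).
Proof.
by elim: w u => [|l w IH] u /=; rewrite ?perm1// pcat1 IH permM.
Qed.

Lemma wpath_cont u w : continuous (wpath u w).
Proof.
elim: w u => [|l w IH] u /=; first exact: cont_cst.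
by apply: pcat_cont => //; [exact: lpath_cont|rewrite lpath1 wpath0].
Qed.

(** The letter [j0] is needed for the empty word, whose path is a vertex: it has to
    lie on an edge that is not labelled [i]. *)
Lemma wpath_avoids i j0 u w : j0 != i -> avoid i w -> avoids G i (wpath u w).
Proof.
move=> j0i; elim: w u => [|l w IH] u /=.
  by move=> _ t t01; exists u, j0, 0; rewrite lexx ler01 edge0.
case/andP=> li aw; apply: avoids_pcat; last exact: IH.
case: l li => j [] /= ji; rewrite /lpath /=; last apply: avoids_revp.
  by move=> t t01; exists u, j, t.
by move=> t t01; exists ((sig j)^-1%g u), j, t.
Qed.

Definition wpathp u w : continuousType R Y := mkcts (@wpath_cont u w).
Definition lpathp u l : continuousType R Y := mkcts (@lpath_cont u l).

(** Classes of chains with rational coefficients in an abelian group: [l q s] is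
    the class of the simplex [s] with coefficient [q]. *)
Section Class.
Variables (M : zmodType) (l : rat -> singular_simplex R 1 Y -> M).
Hypothesis cl : forall q, cocycle (l q).
Hypothesis lD : forall q q' s, l (q + q') s = l q s + l q' s.

Lemma class0 s : l 0 s = 0.
Proof. by apply: (@addrI _ (l 0 s)); rewrite -lD !addr0. Qed.

Lemma classN q s : l (- q) s = - l q s.
Proof. by apply/eqP; rewrite -addr_eq0 -lD addNr class0. Qed.

Lemma class_sum (I : finType) (q : I -> rat) s : l (\sum_i q i) s = \sum_i l (q i) s.
Proof. by apply: (big_morph (fun q => l q s)) => [x y|]; [exact: lD|exact: class0]. Qed.

Local Notation e x j := (spath (edgep G x j)).

Lemma sum_delta (F : T -> 'I_n -> M) x0 j0 :
  (forall x j, ~~ ((x0 == x) && (j0 == j)) -> F x j = 0) ->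
  \sum_x \sum_j F x j = F x0 j0.
Proof.
move=> F0; rewrite (bigD1 x0)//= (bigD1 j0)//= !big1 ?addr0//.
  by move=> x /negPf xx; rewrite big1// => j _; rewrite F0// eq_sym xx.
by move=> j /negPf jj; rewrite F0// eqxx eq_sym jj.
Qed.

Lemma lpath_class q u m :
  l q (spath (lpathp u m)) = \sum_x \sum_j l (q * lcount sig u m x j) (e x j).
Proof.
case: m => j0 []; rewrite /lcount /=.
  rewrite (@sum_delta _ u j0) ?eqxx ?mulr1.
    by congr (l q _); apply: eq_spath.
  by move=> x j /negPf ->; rewrite mulr0 class0.
rewrite (@sum_delta _ ((sig j0)^-1%g u) j0) /=.
  rewrite /lact /= !eqxx mulrN mulr1 classN.
  by apply: (cocycle_revp (cl q)).
by move=> x j /negPf; rewrite /lact /= => ->; rewrite oppr0 mulr0 class0.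
Qed.

Lemma wpath_class q u w :
  l q (spath (wpathp u w)) = \sum_x \sum_j l (q * wcount u w x j) (e x j).
Proof.
elim: w u => [|m w IH] u /=.
  rewrite (@cocycle_cst _ _ _ _ (cl q) _ (vt u))// big1// => x _.
  by rewrite big1// => j _; rewrite mulr0 class0.
rewrite (@cocycle_pcat _ _ _ _ (cl q) (lpathp u m) (wpathp (lact m u) w)).
- rewrite lpath_class IH -big_split; apply: eq_bigr => x _.
  by rewrite -big_split; apply: eq_bigr => j _; rewrite mulrDr lD.
- by rewrite /= /mkcts lpath1 wpath0.
- by [].
Qed.

Lemma transvection_class i w (F : continuousType Y Y) (k : T -> 'I_n -> rat) :
  wact w = 1%g -> transvection G i (fun u => wpath u w) F ->
  \sum_u \sum_j l (k u j) (F \o e u j : singular_simplex R 1 Y) =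
  \sum_u \sum_j l (k u j + twist sig i w k u j) (e u j).
Proof.
move=> w1 [Fj Fi].
have FE q u j : l q (F \o e u j : singular_simplex R 1 Y) =
    l q (e u j) + (if j == i then l q (spath (wpathp (sig i u) w)) else 0).
  case: eqP => [->|/eqP ji].
    have cF : continuous (fun t => F (edge u i t)).
      by apply: cont_comp (@edge_cont _ _ _ _ G u i) _; exact: cts_fun.
    rewrite -(@cocycle_pcat _ _ _ _ (cl q) (edgep G u i) (wpathp (sig i u) w) (mkcts cF)).
    - by congr (l q _); apply/continuousEP.
    - by rewrite /= /mkcts edge1 wpath0.
    - by move=> t t01; exact: Fi.
  rewrite addr0; congr (l q _); apply/continuousEP => t.
  by rewrite /= /mkcts Fj// coef1_01.
transitivity (\sum_u (\sum_j l (k u j) (e u j) + l (k u i) (spath (wpathp (sig i u) w)))).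
  apply: eq_bigr => u _.
  under eq_bigr do rewrite FE.
  by rewrite big_split /= -big_mkcond big_pred1_eq.
rewrite big_split /=.
under [X in _ + X]eq_bigr do rewrite wpath_class.
rewrite [X in _ + X]exchange_big -big_split; apply: eq_bigr => x _ /=.
rewrite [X in _ + X]exchange_big -big_split; apply: eq_bigr => j _ /=.
by rewrite lD /twist class_sum.
Qed.

End Class.
End WordPaths.

Lemma wpath_natural (R : realType) (n : nat) (Y Y' : topologicalType)
    (T T' : finType) (G : graph R Y T n) (G' : graph R Y' T' n)
    (f : Y -> Y') (tau : T -> T') :
  (forall u j t, 0 <= t <= 1 -> f (edge G u j t) = edge G' (tau u) j t) ->
  forall w u t, 0 <= t <= 1 -> f (wpath G u w t) = wpath G' (tau u) w t.
Proof.
move=> fe.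
have i0 := in01_0 R.
have i1 := in01_1 R.
have ts u j : tau (sig G j u) = sig G' j (tau u).
  by apply: (@vt_inj _ _ _ _ G'); rewrite -edge1 -fe// edge1 -(edge0 G _ j) -(edge0 G' _ j) fe.
have ts' u j : tau ((sig G j)^-1%g u) = (sig G' j)^-1%g (tau u).
  by apply: (@perm_inj _ (sig G' j)); rewrite -ts !permKV.
elim=> [|l w IH] u t t01 /=.
  have [_ [j _]] := edge_sur G (vt G u).
  by rewrite -(edge0 G u j) -(edge0 G' _ j) fe.
case/andP: (t01) => t0 t1; rewrite /pcat; case: ifPn => h.
  case: l => j []; rewrite /lpath /=; first by rewrite fe//; lra.
  by rewrite /revp fe ?ts'//; lra.
rewrite -ltNge in h; rewrite IH; last lra.
by case: l => j []; rewrite /lact /= ?ts ?ts'.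
Qed.

(** * Singular chains in low degree *)

Section Chains.
Context (R : realType) (Y : topologicalType).

Definition term k (q : rat) (s : singular_simplex R k Y) : chain R k Y :=
  << q *g s >>.

Lemma termD k q q' (s : singular_simplex R k Y) :
  term (q + q') s = term q s + term q' s.
Proof. by rewrite /term freegUD. Qed.

Lemma termZ k a q (s : singular_simplex R k Y) : a *: term q s = term (a * q) s.
Proof. by apply/eqP/freeg_eqP => y; rewrite coeffZ !coeffU mulrA. Qed.

Lemma termN k q (s : singular_simplex R k Y) : - term q s = term (- q) s.
Proof. by rewrite -scaleN1r termZ mulN1r. Qed.

Lemma chain_ind k (P : chain R k Y -> Prop) : P 0 ->
  (forall q s D, P D -> P (term q s + D)) -> forall c, P c.
Proof.
move=> P0 PD c; elim/freeg_ind_dom0: c => // q s D _ _; exact: PD.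
Qed.

Lemma boundary_term k q (s : singular_simplex R k.+1 Y) :
  boundary (term q s) = q *: simplex_boundary s.
Proof. exact: liftU. Qed.

Lemma boundary_term1 q (s : singular_simplex R 1 Y) :
  boundary (term q s) = term q (s \o @face R 0 o0 : singular_simplex R 0 Y)
    - term q (s \o @face R 0 o1 : singular_simplex R 0 Y).
Proof.
rewrite boundary_term /simplex_boundary sum2 expr0 expr1 scale1r scaleN1r.
by rewrite scalerBr !termZ mulr1.
Qed.

Lemma boundary_term2 q (s : singular_simplex R 2 Y) :
  boundary (term q s) = term q (s \o @face R 1 o0 : singular_simplex R 1 Y)
    - term q (s \o @face R 1 o1 : singular_simplex R 1 Y)
    + term q (s \o @face R 1 o2 : singular_simplex R 1 Y).
Proof.
rewrite boundary_term /simplex_boundary sum3 expr0 expr1 scale1r scaleN1r.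
by rewrite sqrrN expr1n scale1r scalerDr scalerBr !termZ mulr1.
Qed.

Lemma chain_map_term k (Z : topologicalType) (g : continuousType Y Z) q
  (s : singular_simplex R k Y) :
  chain_map g (term q s) = << q *g (g \o s : singular_simplex R k Z) >>.
Proof.
rewrite /chain_map /term [LHS]liftU.
by apply/eqP/freeg_eqP => y; rewrite coeffZ !coeffU mul1r.
Qed.

Lemma term_cocycle (M : zmodType) (p : chain R 1 Y -> M) q :
  {morph p : x y / x + y} -> (forall w : chain R 2 Y, p (boundary w) = 0) ->
  cocycle (fun s => p (term q s)).
Proof.
move=> pD p0 s; have pz : p 0 = 0 by apply: (@addrI _ (p 0)); rewrite -pD !addr0.
have pN x : p (- x) = - p x by apply/eqP; rewrite -addr_eq0 -pD addNr pz.
have := p0 (term q s); rewrite boundary_term2 !pD pN => /eqP.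
by rewrite addrAC subr_eq0 addrC => /eqP.
Qed.

Definition pt0 : @std_simplex R 0.
Proof.
refine (exist (fun x => x \in @std_simplex R 0) (\row_j 1) _).
by rewrite inE; split=> [j|]; rewrite ?big_ord1 !mxE.
Defined.

Lemma face_pt0 : face o0 pt0 = @pt1 R 1 /\ face o1 pt0 = @pt1 R 0.
Proof.
have u01 : unlift (o0 : 'I_2) o1 = Some o0.
  by rewrite (_ : o1 = fintype.lift o0 o0) ?liftK//; exact/val_inj.
have u10 : unlift (o1 : 'I_2) o0 = Some o0.
  by rewrite (_ : o0 = fintype.lift o1 o0) ?liftK//; exact/val_inj.
split; apply: simplex_eq => j; rewrite coef_pt1 /interval_weight coef_face ?clamp0 ?clamp1.
  by case: (ord2P j) => -> /=; rewrite ?unlift_none ?u01 ?subrr// /coef /= mxE.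
by case: (ord2P j) => -> /=; rewrite ?unlift_none ?u10 ?subr0// /coef /= mxE.
Qed.

End Chains.

(** * Singular and combinatorial homology of a graph *)

Section Homology.
Context (R : realType) (Y : topologicalType) (T : finType) (n : nat).
Variable (G : graph R Y T n).
Local Notation e x j := (spath (edgep G x j)).
Local Notation coefs := (T -> 'I_n -> rat).
Implicit Types k : coefs.

Definition gchain k : chain R 1 Y := \sum_u \sum_j term (k u j) (e u j).

Lemma gchainD k k' : gchain (fun u j => k u j + k' u j) = gchain k + gchain k'.
Proof.
rewrite -big_split; apply: eq_bigr => u _; rewrite -big_split; apply: eq_bigr => j _.
exact: termD.
Qed.

Lemma gchainN k : gchain (fun u j => - k u j) = - gchain k.
Proof.
rewrite -sumrN; apply: eq_bigr => u _; rewrite -sumrN; apply: eq_bigr => j _.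
by rewrite termN.
Qed.

Definition homologous (c : chain R 1 Y) k :=
  exists w : chain R 2 Y, boundary w = c - gchain k.

Lemma homologousD c c' k k' : homologous c k -> homologous c' k' ->
  homologous (c + c') (fun u j => k u j + k' u j).
Proof.
move=> [w bw] [w' bw']; exists (w + w').
by rewrite linearD /= bw bw' gchainD opprD addrACA.
Qed.

Lemma homologousN c k : homologous c k -> homologous (- c) (fun u j => - k u j).
Proof. by move=> [w bw]; exists (- w); rewrite linearN /= bw gchainN opprB opprK addrC. Qed.

(** Every cycle is homologous to a sum of edges. Modulo boundaries and edges, a
    singular simplex is the difference of the values of a function of the
    points, by [path_exact]; so a chain is determined by its boundary. *)
Lemma cycle_homologous (c : chain R 1 Y) : boundary c = 0 ->
  exists k, homologous c k.
Proof.
move=> c0.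
pose S (x : chain R 1 Y) := exists k, homologous x k.
have S0 : S 0.
  exists (fun _ _ => 0); exists 0; rewrite linear0 sub0r -gchainN.
  rewrite /gchain big1// => u _; rewrite big1// => j _.
  by rewrite /term oppr0 freegU0.
have SB x y : S x -> S y -> S (x - y).
  by move=> [k xk] [k' yk]; eexists; apply: homologousD xk (homologousN yk).
have [M [p [pD pS]]] := quotient_exists S0 SB.
suff : p c = 0 by move/pS.
have p0 : p 0 = 0 by apply/pS.
have pN x : p (- x) = - p x by apply/eqP; rewrite -addr_eq0 -pD addNr p0.
have pb w : p (boundary w) = 0.
  by apply/pS; have [k [w' bw]] := S0; exists k, (w + w');
    rewrite linearD /= bw sub0r.
have cl q := term_cocycle q pD pb.
have ledge q u j : p (term q (e u j)) = 0.
  apply/pS; exists (fun x i => if (x == u) && (i == j) then q else 0), 0.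
  rewrite linear0 /gchain (bigD1 u)//= (bigD1 j)//= !eqxx /= !big1 ?addr0 ?subrr//.
    move=> x /negPf xu; rewrite big1// => i _; rewrite xu; exact: freegU0.
  by move=> i /negPf ij; rewrite ij; exact: freegU0.
have rp y : {x : T * 'I_n * R | 0 <= x.2 <= 1 /\ edge G x.1.1 x.1.2 x.2 = y}.
  by apply: cid; have [u [j [t tP]]] := edge_sur G y; exists (u, j, t).
(* a path from a vertex to y inside an edge *)
pose P y : singular_simplex R 1 Y :=
  let x := sval (rp y) in spath (subpath (edgep G x.1.1 x.1.2) 0 x.2).
have PE q u j t : 0 <= t <= 1 ->
    p (term q (P (edge G u j t))) = p (term q (spath (subpath (edgep G u j) 0 t))).
  move=> t01; rewrite /P; case: (rp _) => -[[u' j'] t'] /= [t'01 E].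
  apply: (@edge_eqP _ _ _ _ G _ (fun u j t => p (term q (spath (subpath (edgep G u j) 0 t))))
    (fun _ => 0) _ _ u' j' t' u j t t'01 t01 E) => {E} v i.
    exact: (cocycle_subpath0 (cl q)).
  rewrite -[RHS](ledge q v i); congr (p (term q _)); apply: eq_spath => z _.
  by rewrite subpathE; congr (edge _ _ _ _); ring.
pose Phi : chain R 0 Y -> chain R 1 Y :=
  fglift (fun s : singular_simplex R 0 Y => term 1 (P (s (pt0 R))) : chain R 1 Y).
have PhiD x y : Phi (x + y) = Phi x + Phi y.
  have := @fglift_linear _ _ (fun s : singular_simplex R 0 Y =>
    term 1 (P (s (pt0 R))) : chain R 1 Y) 1 x y.
  by rewrite !scale1r.
have PhiE q (s : singular_simplex R 0 Y) : Phi (term q s) = term q (P (s (pt0 R))).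
  by rewrite /Phi [LHS]liftU termZ mulr1.
have Phi0 : Phi 0 = 0 by apply: (@addrI _ (Phi 0)); rewrite -PhiD !addr0.
have main (x : chain R 1 Y) : p x = p (Phi (boundary x)).
  elim/chain_ind: x => [|q s D IH].
    by rewrite linear0 Phi0.
  rewrite linearD /= PhiD !pD IH; congr (_ + _).
  rewrite boundary_term1 termN PhiD !PhiE -termN pD pN /=.
  have [-> ->] := face_pt0 R.
  have := @path_exact R Y T n G M _ (cl q) (fun y => p (term q (P y)))
    (fun u j t => @PE q u j t) (path_of s).
  by rewrite path_ofK.
by rewrite main c0 Phi0.
Qed.

(** The coefficient of an edge is the value of the dual cocycle. *)
Lemma gchain_inj k : homologous 0 k -> forall u j, k u j = 0.
Proof.
move=> [w bw] u j.
have [l cl lE] := edge_cocycle G u j.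
pose L : chain R 1 Y -> rat^o := fglift (l : singular_simplex R 1 Y -> rat^o).
have LD x y : L (x + y) = L x + L y.
  have := @fglift_linear _ _ (l : singular_simplex R 1 Y -> rat^o) 1 x y.
  by rewrite !scale1r.
have LE q s : L (term q s) = q * l s by exact: liftU.
have L0 : L 0 = 0 by apply: (@addrI _ (L 0)); rewrite -LD !addr0.
have LN x : L (- x) = - L x by apply/eqP; rewrite -addr_eq0 -LD addNr L0.
have Lb (x : chain R 2 Y) : L (boundary x) = 0.
  elim/chain_ind: x => [|q s D IH]; first by rewrite linear0.
  rewrite linearD /= LD IH addr0 boundary_term2 !LD LN !LE cl; ring.
have : L (gchain k) = 0.
  have -> : gchain k = - boundary w by rewrite bw sub0r opprK.
  by rewrite LN Lb oppr0.
rewrite /gchain (big_morph L LD L0).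
under eq_bigr do rewrite (big_morph L LD L0).
rewrite (bigD1 u)//= (bigD1 j)//= !big1 ?addr0.
- by rewrite LE lE !eqxx mulr1.
- move=> x /negPf xu; rewrite big1// => i _; by rewrite LE lE xu mulr0.
- by move=> i /negPf ij; rewrite LE lE ij andbF mulr0.
Qed.

Lemma transvection_homologous i w (F : continuousType Y Y) (c : chain R 1 Y) k :
  wact (sig G) w = 1%g -> transvection G i (fun u => wpath G u w) F ->
  homologous c k ->
  homologous (chain_map F c) (fun u j => k u j + twist (sig G) i w k u j).
Proof.
move=> w1 tF [v bv].
pose S (x : chain R 1 Y) := exists w : chain R 2 Y, boundary w = x.
have S0 : S 0 by exists 0; rewrite linear0.
have SB x y : S x -> S y -> S (x - y).
  by move=> [a <-] [b <-]; exists (a - b); rewrite linearB.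
have [M [p [pD pS]]] := quotient_exists S0 SB.
have p0 : p 0 = 0 by apply/pS.
have pN x : p (- x) = - p x by apply/eqP; rewrite -addr_eq0 -pD addNr p0.
apply/pS; rewrite pD pN; apply/eqP; rewrite subr_eq0; apply/eqP.
transitivity (p (chain_map F (gchain k))).
  have -> : c = gchain k + boundary v by rewrite bv addrC subrK.
  rewrite linearD /= pD -[RHS]addr0; congr (_ + _).
  by apply/pS; exists (chain_map F v); rewrite boundary_chain_map.
have pb w' : p (boundary w') = 0 by apply/pS; exists w'.
have := @transvection_class R Y T n G M (fun q s => p (term q s))
  (fun q => term_cocycle q pD pb) _ i w F k w1 tF.
rewrite /gchain linear_sum /= (big_morph p pD p0) => H.
under eq_bigr => u _.
  rewrite linear_sum /= (big_morph p pD p0).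
  under eq_bigr do rewrite chain_map_term.
  over.
rewrite -/term H.
  rewrite (big_morph p pD p0); apply: eq_bigr => u _.
  by rewrite (big_morph p pD p0).
by move=> q q' s; rewrite termD pD.
Qed.

End Homology.

(** * Lifting of paths to covering spaces *)

Section Lifting.
Context (R : realType) (E B : topologicalType).
Variable f : E -> B.
Hypothesis cf : covering_map f.

(** Where both lifts stay in one sheet each, agreement at one point means that the
    two sheets are the same. *)
Lemma local_lift_uniq (g g' : R -> E) (x : R) : continuous g -> continuous g' ->
  (forall t, 0 <= t <= 1 -> f (g t) = f (g' t)) -> 0 <= x <= 1 ->
  exists2 A : set R, nbhs x A & forall z z', A z -> A z' -> 0 <= z <= 1 ->
    0 <= z' <= 1 -> g z = g' z -> g z' = g' z'.
Proof.
move=> cg cg' fg x01.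
have [_ _ /(_ (f (g x)))[U [oU Ux [I [S [oS tS SU Ssec]]]]]] := cf.
have [i _ Sx] : (\bigcup_i S i) (g x) by rewrite SU.
have [i' _ Sx'] : (\bigcup_i S i) (g' x) by rewrite SU /= -fg.
exists (g @^-1` S i `&` g' @^-1` S i').
  by apply: filterI; [apply: cg|apply: cg']; apply: open_nbhs_nbhs; split.
move=> z z' [/= Sz Sz'] [/= Sw Sw'] z01 z'01 gz.
have ii : i = i'.
  by apply: tS => //; exists (g z); split => //; rewrite gz.
have [s [_ _ sf]] := Ssec i.
by rewrite -(sf _ Sw) fg// sf// ii.
Qed.

Lemma lift_unique (g g' : R -> E) (t0 : R) : continuous g -> continuous g' ->
  (forall t, 0 <= t <= 1 -> f (g t) = f (g' t)) -> 0 <= t0 <= 1 ->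
  g t0 = g' t0 -> forall t, 0 <= t <= 1 -> g t = g' t.
Proof.
move=> cg cg' fg t001 e0 t t01.
pose Q (A : set R) := forall z z', A z -> A z' -> 0 <= z <= 1 ->
    0 <= z' <= 1 -> g z = g' z -> g z' = g' z'.
have [||N NP] := @lebesgue_unit R Q.
- by move=> A C sAC QC z z' Az Az'; apply: QC; exact: sAC.
- by move=> x x01; exact: local_lift_uniq.
pose x (k : nat) := t0 + k%:R / N.+1%:R * (t - t0).
have xk k : (k <= N.+1)%N -> 0 <= x k <= 1.
  move=> kN; rewrite /x.
  have : 0 <= k%:R / N.+1%:R :> R by rewrite divr_ge0.
  have : k%:R / N.+1%:R <= 1 :> R by rewrite ler_pdivrMr ?ltr0n// mul1r ler_nat.
  move: (_ / _) t001 t01 => c /andP[? ?] /andP[? ?] c1 c0.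
  by apply/andP; split; nra.
have ind k : (k <= N.+1)%N -> g (x k) = g' (x k).
  have M0 : N.+1%:R != 0 :> R by rewrite gt_eqF.
  elim: k => [|k IH] kN; first by rewrite /x !mul0r addr0.
  have kN' := ltnW kN; apply: (NP (x k) (xk _ kN') (x k)) => //; last exact: IH.
  - by rewrite /= subrr normr0 invr_ge0.
  - rewrite /= /x (_ : _ - _ = N.+1%:R^-1 * (t0 - t)); last first.
    by rewrite -(natr1 k); move: (N.+1%:R) (M0 : N.+1%:R != 0 :> R) => M M0'; field.
    rewrite normrM [X in X * _]ger0_norm; last by rewrite invr_ge0.
    apply: ler_piMr; first by rewrite invr_ge0.
    rewrite ler_norml.
    by move: t001 t01 => /andP[? ?] /andP[? ?]; apply/andP; split; lra.
  - exact: xk.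
  - exact: xk.
have := ind _ (leqnn _); rewrite /x divff ?pnatr_eq0// mul1r.
by rewrite (_ : t0 + (t - t0) = t)//; ring.
Qed.

(** The path is cut into pieces with images in evenly covered sets, and the lift
    is prolonged over one piece after the other. *)
Lemma lift_exists (c : R -> B) y : continuous c -> f y = c 0 ->
  exists g : R -> E, [/\ continuous g, g 0 = y &
    forall t, 0 <= t <= 1 -> f (g t) = c t].
Proof.
move=> cc fy.
pose Q (A : set R) := exists U, [/\ open U, evenly_covered f U &
  forall t, A t -> U (c t)].
have [||N NP] := @lebesgue_unit R Q.
- by move=> A C sAC [U [oU eU CU]]; exists U; split=> // t /sAC /CU.
- move=> x _; have [_ _ /(_ (c x))[U [oU Ux eU]]] := cf.
  exists (c @^-1` U); last by exists U.
  by apply: cc; apply: open_nbhs_nbhs.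
have N0 : 0 < N.+1%:R :> R by rewrite ltr0n.
have ind k : (k <= N.+1)%N -> exists g : R -> E, [/\ continuous g, g 0 = y &
    forall t, 0 <= t <= k%:R / N.+1%:R -> f (g t) = c t].
  elim: k => [|k IH] kN.
    exists (fun=> y); split=> //; first exact: cont_cst.
    by move=> t; rewrite mul0r => t0; rewrite fy (le_anti t0).
  have {IH}[g [cg g0 gE]] := IH (ltnW kN).
  set a := k%:R / N.+1%:R in gE.
  have a0 : 0 <= a by rewrite divr_ge0.
  have a1 : a <= 1 by rewrite ler_pdivrMr// mul1r ler_nat ltnW.
  have [|U [oU [I [S [oS tS SU Ssec]]] AU]] := NP a; first by rewrite a0 a1.
  have Ua : U (c a) by apply: AU; rewrite /= subrr normr0 invr_ge0.
  have [i _ Sa] : (\bigcup_i S i) (g a) by rewrite SU /= gE// a0 lexx.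
  have [s [cs Ss sf]] := Ssec i.
  (* [ca] stays in the next piece, so that the section [s] is only used where it
     is continuous *)
  pose ca t := Num.max a (Num.min (a + N.+1%:R^-1) t).
  have cca : continuous ca by rewrite /ca; rcont.
  have caU t : U (c (ca t)).
    apply: AU; rewrite /= /ca ler_norml.
    have : 0 < N.+1%:R^-1 :> R by rewrite invr_gt0.
    move: (_^-1) => e e0.
    have h1 : a <= Num.max a (Num.min (a + e) t) by rewrite le_max lexx.
    have h2 : Num.max a (Num.min (a + e) t) <= a + e.
      by rewrite ge_max ge_min lexx /= andbT; lra.
    by apply/andP; split; lra.
  have csc : continuous (fun t => s (c (ca t))).
    move=> t; move: cs; rewrite continuous_open_subspace// => cs.
    apply: (@continuous_comp _ _ _ (fun t => c (ca t)) s).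
      exact: (cont_comp cca cc).
    by apply: cs; rewrite inE.
  exists (fun t => if t - a <= 0 then g t else s (c (ca t))); split.
  - apply: (@paste_cont R R E (fun t => t - a)) => //; first by rcont.
    move=> t /eqP; rewrite subr_eq0 => /eqP ->.
    have -> : ca a = a by rewrite /ca (min_idPr _) ?maxxx// lerDl invr_ge0.
    by rewrite -gE ?sf// a0 lexx.
  - by rewrite sub0r oppr_le0 a0.
  - move=> t /andP[t0 t1]; case: ifPn => [ta|].
      by rewrite gE// t0 /= -subr_le0.
    rewrite subr_le0 -ltNge => ta.
    have -> : ca t = t.
      rewrite /ca (min_idPr _) ?(max_idPr _) ?(ltW ta)//.
      by apply: le_trans t1 _; rewrite /a -natr1 mulrDl mul1r.
    have Ut : U (c t).
      apply: AU; rewrite /= ler_norml.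
      have t1' : t <= a + N.+1%:R^-1.
        by apply: le_trans t1 _; rewrite /a -natr1 mulrDl mul1r.
      have : 0 < N.+1%:R^-1 :> R by rewrite invr_gt0.
      by move: (_^-1) t1' => e t1' e0; apply/andP; split; lra.
    by have [] := Ss _ Ut.
have [g [cg g0 gE]] := ind _ (leqnn _).
by exists g; split=> // t t01; rewrite gE// divff// gt_eqF.
Qed.

Lemma cover_hausdorff : hausdorff_space B -> hausdorff_space E.
Proof.
move=> hB; have [cont_f _ ec] := cf.
move=> p q cl; have fpq : f p = f q.
  apply: hB => U V nU nV.
  have [|| z [Uz Vz]] := cl (f @^-1` U) (f @^-1` V).
  - exact: cont_f.
  - exact: cont_f.
  by exists (f z).
have [U [oU Ux [I [S [oS tS SU Ssec]]]]] := ec (f p).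
have [i _ Sp] : (\bigcup_i S i) p by rewrite SU.
have [i' _ Sq] : (\bigcup_i S i) q by rewrite SU /= -fpq.
have [||z [Sz Sz']] := cl (S i) (S i').
- exact: open_nbhs_nbhs.
- exact: open_nbhs_nbhs.
have ii : i = i' by apply: tS => //; exists z.
by have [s [_ _ sf]] := Ssec i; rewrite -(sf _ Sp) fpq sf// ii.
Qed.

End Lifting.

(** * The rose as a graph with one vertex *)

Section Rose.
Context (R : realType) (n : nat).

Lemma circle_pt_subproof (t : R) :
  (cos (t * (pi *+ 2)), sin (t * (pi *+ 2))) \in @unit_circle R.
Proof. by rewrite inE /unit_circle /= cos2Dsin2. Qed.

Definition circle_pt (t : R) : @unit_circle R :=
  exist (fun x => x \in @unit_circle R) _ (circle_pt_subproof t).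

Lemma circle_pt_cont : continuous circle_pt.
Proof.
apply: continuous_comp_initial.
have cm : continuous (fun t : R => t * (pi *+ 2)) by rcont.
by apply: cont_pair; [exact: cont_comp cm (@continuous_cos R)|
  exact: cont_comp cm (@continuous_sin R)].
Qed.

Lemma circle_pt0 : circle_pt 0 = circle_base R.
Proof. by apply/val_inj; rewrite /= mul0r cos0 sin0. Qed.

Lemma circle_pt1 : circle_pt 1 = circle_base R.
Proof. by apply/val_inj; rewrite /= mul1r cos2pi sin2pi. Qed.

(** Equal points have parameters with cos (2 pi (t - t')) = 1, which means that
    sin (pi (t - t')) = 0. *)
Lemma circle_pt_inj (t t' : R) : 0 <= t < 1 -> 0 <= t' < 1 ->
  circle_pt t = circle_pt t' -> t = t'.
Proof.
wlog tt : t t' / t' <= t => [H|] t0 t'0 e.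
  have [tt|tt] := leP t' t; first exact: H.
  by symmetry; apply: H; rewrite ?(ltW tt).
apply/eqP; rewrite eq_le tt andbT leNgt; apply/negP => lt.
have [ec es] : cos (t * (pi *+ 2)) = cos (t' * (pi *+ 2)) /\
    sin (t * (pi *+ 2)) = sin (t' * (pi *+ 2)).
  by have := congr1 val e => /= -[-> ->].
have s0 : 0 < sin ((t - t') * pi).
  apply: sin_gt0_pi; rewrite mulr_gt0 ?pi_gt0 ?subr_gt0//=.
  by rewrite gtr_pMl ?pi_gt0//; move: t0 t'0; lra.
have : cos (((t - t') * pi) *+ 2) = 1.
  by rewrite -mulrnAr mulrBl cosB ec es -!expr2 cos2Dsin2.
rewrite cos_mulr2n cos2sin2 => /eqP.
rewrite mulrnBl addrAC -subr_eq0 => /eqP h.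
have : sin ((t - t') * pi) ^+ 2 = 0 by lra.
by move/eqP; rewrite sqrf_eq0 gt_eqF.
Qed.

Lemma circle_pt_sur (x : @unit_circle R) : exists2 t, 0 <= t <= 1 & circle_pt t = x.
Proof.
case: x => -[a b] h; have := h; rewrite inE /unit_circle /= => ab.
have a1 : -1 <= a <= 1.
  rewrite -ler_norml -(@expr_le1 _ 2)// real_normK ?num_real//.
  by rewrite -ab lerDl sqr_ge0.
have p0 := @pi_gt0 R.
have b2 : b ^+ 2 = 1 - a ^+ 2 by rewrite -ab addrAC subrr add0r.
have p2 : 0 < pi *+ 2 :> R by rewrite mulr2n; lra.
have p20 : pi *+ 2 != 0 :> R by rewrite gt_eqF.
have := acos_ge0 a1; have := acos_lepi a1; set c := acos a => cp c0.
have cc : cos c = a by rewrite acosK// in_itv.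
have sc : sin c = `|b| by rewrite sin_acos// -b2 sqrtr_sqr.
have x0 : 0 <= c / (pi *+ 2) by rewrite divr_ge0// ltW.
have x1 : c / (pi *+ 2) <= 1.
  by rewrite ler_pdivrMr// mul1r mulr2n; lra.
have [b0|b0] := leP 0 b.
  exists (c / (pi *+ 2)).
    by rewrite x0.
  by apply/val_inj; rewrite /= divfK// cc sc ger0_norm.
exists (1 - c / (pi *+ 2)).
  by apply/andP; split; lra.
apply/val_inj; rewrite /= mulrBl mul1r divfK// addrC.
by rewrite cosD2pi sinD2pi cosN sinN cc sc ltr0_norm// opprK.
Qed.

Lemma circle_hausdorff : hausdorff_space (@unit_circle R).
Proof.
move=> p q cl; apply/val_inj.
apply: (hausdorff_pair (@Rhausdorff R) (@Rhausdorff R)) => U V nU nV.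
have cv : continuous (\val : @unit_circle R -> R * R) by exact: initial_continuous.
have [||z [Uz Vz]] := cl (\val @^-1` U) (\val @^-1` V).
- exact: cv.
- exact: cv.
by exists (\val z).
Qed.

Local Notation X := (rose R n).

Definition petal (j : 'I_n) (t : R) : X :=
  wedge_lift (fun _ : 'I_n => circle_base R) (i := j) (circle_pt (clamp t)).

Lemma petal_cont j : continuous (petal j).
Proof.
apply: cont_comp (@wedge_lift_continuous _ _ _ j).
exact: cont_comp (@clamp_cont R) circle_pt_cont.
Qed.

Lemma petal_eq j t j' t' : 0 < t < 1 -> 0 <= t' <= 1 ->
  petal j t = petal j' t' -> j = j' /\ t = t'.
Proof.
move=> t0 t'0 e.
(* the retraction of the rose to its [j]-th circle *)
pose W := wedge_fun (p0 := fun _ : 'I_n => circle_base R)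
  (fun k (x : @unit_circle R) => if k == j then x else circle_base R).
have WE k x : W (wedge_lift _ (i := k) x) = if k == j then x else circle_base R.
  by rewrite /W wedge_lift_funE// => i i'; rewrite !if_same.
have := congr1 W e; rewrite /petal !WE eqxx !clampK//; last by case/andP: t0 => /ltW-> /ltW->.
have nb : circle_pt t <> circle_base R.
  rewrite -circle_pt0 => h; have : t = 0.
    apply: circle_pt_inj h; first by case/andP: t0 => /ltW ->.
    by rewrite lexx ltr01.
  by move=> tz; rewrite tz ltxx in t0.
case: eqP => [-> {}e|_ /nb //]; split=> //.
apply: circle_pt_inj => //; first by case/andP: t0 => /ltW ->.
case/andP: t'0 => -> /=; rewrite le_eqVlt => /predU1P[t1|//].
by move: e; rewrite t1 circle_pt1 => /nb.
Qed.

Hypothesis n_gt0 : (0 < n)%N.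

Definition rose_base : X :=
  wedge_lift (fun _ : 'I_n => circle_base R) (i := Ordinal n_gt0) (circle_base R).

Lemma petal0 j : petal j 0 = rose_base.
Proof. by rewrite /petal clamp0 circle_pt0; exact: (@wedge_liftE _ _ (fun _ : 'I_n => circle_base R) _ (circle_base R) _ (circle_base R)). Qed.

Lemma petal1 j : petal j 1 = rose_base.
Proof. by rewrite /petal clamp1 circle_pt1; exact: (@wedge_liftE _ _ (fun _ : 'I_n => circle_base R) _ (circle_base R) _ (circle_base R)). Qed.

Lemma petal_base j t : 0 < t < 1 -> petal j t <> rose_base.
Proof.
move=> t0; rewrite -(petal0 j) => /petal_eq -/(_ t0) h.
have [|_ tz] := h; first by rewrite lexx ler01.
by rewrite tz ltxx in t0.
Qed.

Lemma petal_sur (x : X) : exists j t, 0 <= t <= 1 /\ petal j t = x.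
Proof.
have : [set: X] x by [].
rewrite -wedgeTE => -[j _ [y _ <-]].
have [t t01 ty] := circle_pt_sur y.
by exists j, t; rewrite /petal clampK// ty.
Qed.

Lemma rose_hausdorff : hausdorff_space X.
Proof. by apply: wedge_hausdorff => _; exact: circle_hausdorff. Qed.

Program Definition rose_graph : graph R X unit n := {|
  vt := fun _ => rose_base;
  edge := fun _ j t => petal j t;
  sig := fun _ => 1%g |}.
Next Obligation. exact: rose_hausdorff. Qed.
Next Obligation. by move=> u j; exact: petal_cont. Qed.
Next Obligation. by move=> u j; exact: petal0. Qed.
Next Obligation. by move=> u j; exact: petal1. Qed.
Next Obligation. by move=> y; exists tt; exact: petal_sur. Qed.
Next Obligation. by move=> [] []. Qed.
Next Obligation. by move=> u j t u'; exact: petal_base. Qed.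
Next Obligation.
move=> [] j t [] j' t' t0 /andP[t'0 t'1] /petal_eq -/(_ t0) h.
by have [|-> ->] := h; first by rewrite (ltW t'0) (ltW t'1).
Qed.

End Rose.

(** * Finite covers of the rose *)

Section Cover.
Context (R : realType) (n : nat) (n_gt0 : (0 < n)%N).
Context (Y : topologicalType) (f : Y -> rose R n).
Hypothesis cf : covering_map f.
Local Notation base := (rose_base R n_gt0).

(** The edges are the lifts of the petals, and unique lifting gives all the
    axioms of a graph. *)
Lemma cover_graph : finite_set (f @^-1` [set base]) ->
  exists (T : finType) (G : graph R Y T n),
  forall u j t, 0 <= t <= 1 -> f (edge G u j t) = petal j t.
Proof.
move=> fin; have [cont_f _ _] := cf.
pose T : finType := fset_set (f @^-1` [set base]).
have TP (u : T) : f (val u) = base.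
  by have := valP u; rewrite in_fset_set// inE.
have mkT y : f y = base -> {u : T | val u = y}.
  move=> fy; have yT : y \in fset_set (f @^-1` [set base]).
    by rewrite in_fset_set// inE.
  by exists (FSetSub yT).
have i0 := in01_0 R.
have i1 := in01_1 R.
have Lex (u : T) j : {g : R -> Y | [/\ continuous g, g 0 = val u &
    forall t, 0 <= t <= 1 -> f (g t) = petal j t]}.
  apply: cid; apply: (lift_exists cf); first exact: petal_cont.
  by rewrite TP petal0.
pose L u j := sval (Lex u j).
have cL u j : continuous (L u j) by have [] := svalP (Lex u j).
have L0 u j : L u j 0 = val u by have [] := svalP (Lex u j).
have fL u j t : 0 <= t <= 1 -> f (L u j t) = petal j t.
  by have [_ _] := svalP (Lex u j); exact.
have Send u j : {u' : T | val u' = L u j 1}.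
  by apply: mkT; rewrite fL// petal1.
pose s0 j u := sval (Send u j).
have L1 u j : L u j 1 = val (s0 j u) by rewrite (svalP (Send u j)).
have Luniq u u' j t : 0 <= t <= 1 -> L u j t = L u' j t -> u = u'.
  move=> t01 e; apply: val_inj; rewrite -(L0 u j) -(L0 u' j).
  by apply: (lift_unique cf (cL u j) (cL u' j) _ t01 e i0) => z z01; rewrite !fL.
have s_inj j : injective (s0 j).
  move=> u u' e; apply: (@Luniq u u' j 1) => //.
  by rewrite !L1 e.
unshelve eexists T, (@Graph R Y T n _ val L (fun j => perm (@s_inj j)) cL L0 _ _ _ _ _).
- by apply: (cover_hausdorff cf); exact: rose_hausdorff.
- by move=> u j; rewrite permE; exact: L1.
(* the lift of a petal that ends at y is found by lifting the reversed path *)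
- move=> y; have [j [t [t01 e]]] := petal_sur (f y).
  case/andP: (t01) => t0 t1.
  have cp : continuous (fun s : R => petal (n := n) j (t * (1 - s))).
    by apply: cont_comp (@petal_cont R n j); rcont.
  have [|q [cq q0 qE]] := @lift_exists R _ _ f cf _ y cp.
    by rewrite subr0 mulr1.
  have [|u uE] := mkT (q 1); first by rewrite qE// subrr mulr0 petal0.
  exists u, j, t; split=> //.
  have := @lift_unique R _ _ f cf (fun s => L u j (t * s)) (fun s => q (1 - s)) 0 _ _ _ i0.
  rewrite mulr0 L0 subr0 uE => /(_ _ _ _ erefl 1 i1).
  rewrite mulr1 subrr q0; apply.
  + by apply: cont_comp (cL u j); rcont.
  + by apply: cont_comp cq; rcont.
  + move=> s /andP[s_0 s_1]; rewrite fL ?qE; first by congr (petal _ _); ring.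
      by apply/andP; split; lra.
    by rewrite mulr_ge0//= mulr_ile1.
- exact: val_inj.
- move=> u j t u' t01 e; apply: (@petal_base R n n_gt0 j t t01).
  by rewrite -(fL u j) ?e ?TP//; case/andP: t01 => /ltW-> /ltW->.
- move=> u j t u' j' t' t01 t'01 e.
  have t01' : 0 <= t <= 1 by case/andP: t01 => /ltW-> /ltW->.
  have t'01' : 0 <= t' <= 1 by case/andP: t'01 => /ltW-> /ltW->.
  have [jj tt] : j = j' /\ t = t'.
    by apply: (@petal_eq R n j t j' t') => //; rewrite -(fL u)// -(fL u')// e.
  by rewrite -jj -tt in e *; split=> //; exact: Luniq e.
- by move=> u j t t01 /=; exact: fL.
Qed.

(** Composed with a lift of a petal, a deck transformation gives another lift of
    it, and lifts are unique. *)
Lemma deck_graph (T : finType) (G : graph R Y T n) (g : Y -> Y) :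
  (forall u j t, 0 <= t <= 1 -> f (edge G u j t) = petal j t) ->
  continuous g -> f \o g = f ->
  exists tau : T -> T, forall u j t, 0 <= t <= 1 ->
    g (edge G u j t) = edge G (tau u) j t.
Proof.
move=> fE cg fg.
have i0 := in01_0 R.
have vertex y : f y = base -> {u : T | vt G u = y}.
  move=> fy; apply: cid; have [u [j [t [t01 e]]]] := edge_sur G y.
  case: (le01P t01) => [tz|tz|/petal_base - /(_ n n_gt0 j)].
  - by exists u; rewrite -e tz edge0.
  - by exists (sig G j u); rewrite -e tz edge1.
  - by rewrite -(fE u)// e fy.
have fv u : f (g (vt G u)) = base.
  have -> : f (g (vt G u)) = f (vt G u) by rewrite -[LHS]/((f \o g) _) fg.
  by rewrite -(edge0 G u (Ordinal n_gt0)) fE// petal0.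
exists (fun u => sval (vertex _ (fv u))) => u j t t01.
have cgE : continuous (fun s => g (edge G u j s)).
  by apply: cont_comp cg; exact: edge_cont.
apply: (@lift_unique R _ _ f cf (fun s => g (edge G u j s)) _ 0) => //.
- exact: edge_cont.
- move=> s s01; rewrite fE// -[LHS]/((f \o g) _) fg fE//.
- by rewrite !edge0 (svalP (vertex _ (fv u))).
Qed.

End Cover.

Local Open Scope quotient_scope.

(** * Transvections acting on homology *)

Section Classes.
Context (R : realType) (Y : topologicalType) (T : finType) (n : nat).
Variable (G : graph R Y T n).
Implicit Types (k : T -> 'I_n -> rat) (v : H1 R Y).

Definition represents v k :=
  exists2 z : Defs.cycle1 R Y, v = \pi_(H1 R Y) z & homologous G (val z) k.

Lemma represents_exists v : exists k, represents v k.
Proof.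
elim/quotW: v => z; have [k zk] : exists k, homologous G (val z) k.
  by apply: cycle_homologous; case: z => z /= /eqP.
by exists k, z.
Qed.

Lemma representsD v v' k k' : represents v k -> represents v' k' ->
  represents (v + v') (fun u j => k u j + k' u j).
Proof.
move=> [z -> zk] [z' -> zk']; exists (z + z'); first by rewrite H1_piD.
exact: homologousD.
Qed.

Lemma representsN v k : represents v k -> represents (- v) (fun u j => - k u j).
Proof.
move=> [z -> zk]; exists (- z); last exact: homologousN.
by rewrite -[- z]scaleN1r H1_piZ scaleN1r.
Qed.

Lemma represents_inj v k k' : represents v k -> represents v k' ->
  forall u j, k u j = k' u j.
Proof.
move=> [z -> [w bw]] [z' /H1_eqP[w' bw'] [w'' bw'']] u j; apply/eqP.
rewrite -subr_eq0; apply/eqP.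
apply: (@gchain_inj R Y T n G (fun u j => k u j - k' u j)).
exists (w - w'' - w'); rewrite !linearB /= bw bw' bw'' gchainD gchainN.
rewrite sub0r !opprB -!addrA addKr (addrA (- gchain G k)) addrC subrK.
by rewrite addrC.
Qed.

Lemma represents_eq v v' k : represents v k -> represents v' k -> v = v'.
Proof.
move=> [z -> [w bw]] [z' -> [w' bw']]; apply/H1_eqP; exists (w - w').
by rewrite linearB /= bw bw' opprB addrA subrK.
Qed.

Lemma represents0 k v : (forall u j, k u j = 0) -> represents v k -> v = 0.
Proof.
move=> k0 vk; have := representsD vk (representsN vk); rewrite subrr.
have -> : (fun u j => k u j + - k u j) = k; last exact: represents_eq.
by apply/funext => u; apply/funext => j; rewrite k0 subrr.
Qed.

Lemma represents_transvection i w (F : continuousType Y Y) v k :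
  wact (sig G) w = 1%g -> transvection G i (fun u => wpath G u w) F ->
  represents v k ->
  represents (H1_map F v) (fun u j => k u j + twist (sig G) i w k u j).
Proof.
move=> w1 tF [z -> zk]; exists (cycle1_map F z); first by rewrite H1_map_pi.
exact: (transvection_homologous w1 tF).
Qed.

End Classes.

Lemma infinite_injective_range (V : Type) (A : set V) (a : nat -> V) :
  injective a -> (forall d, A (a d)) -> infinite_set A.
Proof.
move=> ai aA; apply: (@sub_infinite_set _ (range a)); first by move=> _ [d _ <-].
have /eq_finite_set e : (range a #= [set: nat])%card.
  by apply: inj_card_eq => ? ? _ _ /ai.
by rewrite e; exact: infinite_nat.
Qed.

(** * Infinite orbits *)

Theorem theorem1p1 (R : realType) (n : nat) (hn : (3 <= n)%N)
    (Y : topologicalType) (f : Y -> rose R n) (hf : finite_regular_cover f)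
    (v : H1 R Y) (hv : v <> 0) :
  infinite_set (Gamma_orbit f v) /\
  exists (F : continuousType (rose R n) (rose R n)) (Ft : continuousType Y Y),
    [/\ homotopy_equivalence R F,
        lift_of f F Ft
      & exists psi : H1 R Y -> H1 R Y,
        [/\ cancel (H1_map Ft) psi,
            cancel psi (H1_map Ft)
          & infinite_set
              [set w | exists d : int, w = ziter (H1_map Ft) psi d v]]].
Proof.
have [cf _ fin _] := hf.
have n0 : (0 < n)%N by apply: leq_trans hn.
have [T [G fG]] := cover_graph cf (fin (rose_base R n0)).
pose X := rose_graph R n0.
have [k vk] := represents_exists G v.
have [u0 [j0 k0]] : exists u j, k u j != 0.
  apply: contrapT => nk; apply: hv; apply: (represents0 _ vk) => u j.
  by apply/eqP; apply: contrapT => kuj; apply: nk; exists u, j; apply/negP.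
have [i [w [aw w1 [x [j S0]]]]] := twist_exists (sig G) hn k0.
have [j1 j1i] : exists j1 : 'I_n, j1 != i.
  have : (0 < #|[set~ i]%SET|)%N by rewrite cardsC1 card_ord; case: (n) hn => [|[|]].
  by move=> /card_gt0P[j1]; rewrite !inE; exists j1.
have fXG u j' t : 0 <= t <= 1 -> f (edge G u j' t) = edge X tt j' t.
  by move=> t01; rewrite fG.
(* The powers of [w] give elements of the group Gamma, one for each d; they add
   d times the same vector to v. *)
have transv d : exists (F : continuousType (rose R n) (rose R n))
    (Ft : continuousType Y Y),
    [/\ transvection G i (fun u => wpath G u (wpow w d)) Ft,
        homotopy_equivalence R F, lift_of f F Ft & trivial_on_deck f Ft].
  have awd := wpow_avoid d aw; have w1d := wpow_act d w1.
  have wX u : wpath X u (wpow w d) 1 = vt X u by rewrite wpath1; case: u; case: (wact _ _ _).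
  have [F tF] := transvection_exists i (fun u => @wpath_cont _ _ _ _ X u (wpow w d))
    (fun u => wpath0 X u (wpow w d)) wX.
  have wG u : wpath G u (wpow w d) 1 = vt G u by rewrite wpath1 w1d perm1.
  have [Ft tFt] := transvection_exists i (fun u => @wpath_cont _ _ _ _ G u (wpow w d))
    (fun u => wpath0 G u (wpow w d)) wG.
  exists F, Ft; split=> //.
  - apply: (transvection_equivalence _ _ wX _ tF) => u.
    + exact: wpath_cont.
    + exact: wpath0.
    + exact: wpath_avoids j1i awd.
  - apply/funext => y /=; apply: (transvection_natural (tau := fun=> tt) fXG _ tFt tF).
    by move=> u t; exact: (wpath_natural (tau := fun=> tt) fXG).
  - move=> g [fg _]; apply/funext => y /=.
    have [tau tauE] := deck_graph n0 cf fG (@cts_fun _ _ g) fg.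
    symmetry; apply: (transvection_natural tauE _ tFt tFt).
    by move=> u t; exact: (wpath_natural tauE).
have inj (a : nat -> H1 R Y) : (forall d, represents G (a d)
    (fun x j => k x j + d%:R * twist (sig G) i w k x j)) -> injective a.
  move=> aE d d' e; have := aE d'; rewrite -e => /represents_inj/(_ (aE d) x j).
  by move/addrI/(mulIf S0)/eqP; rewrite eqr_nat => /eqP.
split.
  have aex d : {b : H1 R Y | Gamma_orbit f v b /\ represents G b
      (fun x j => k x j + d%:R * twist (sig G) i w k x j)}.
    apply: cid; have [F [Ft [tFt hF lF dF]]] := transv d.
    exists (H1_map Ft v); split.
      by exists Ft => //; exists F => //; split => //; exists Ft.
    have := represents_transvection (wpow_act d w1) tFt vk.
    congr represents; apply/funext => x'; apply/funext => j'.
    by rewrite twist_wpow.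
  apply: (@infinite_injective_range _ _ (fun d => sval (aex d))).
    by apply: inj => d; have [] := svalP (aex d).
  by move=> d; have [] := svalP (aex d).
have [F [Ft [tFt hF lF _]]] := transv 1%N.
exists F, Ft; split=> //.
have w1w : wpow w 1 = w by rewrite /wpow /= cats0.
rewrite w1w in tFt.
have step v' k' := @represents_transvection _ _ _ _ G i w Ft v' k' w1 tFt.
(* only the coefficients at the letter i matter, and the result has none *)
have tw_eq k1 k2 : (forall u, k1 u i = k2 u i) ->
    twist (sig G) i w k1 = twist (sig G) i w k2.
  move=> e; apply/funext => x'; apply/funext => j'; apply: eq_bigr => u _.
  by rewrite e.
have twi k' u : twist (sig G) i w k' u i = 0 by exact: twist_avoid.
(* Transvections are unipotent: if F = 1 + N with N N = 0, then 2 - F is the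
   inverse of F. *)
pose psi (v' : H1 R Y) : H1 R Y := v' + v' - H1_map Ft v'.
exists psi; split.
- move=> v'; have [k' v'k'] := represents_exists G v'.
  apply: (represents_eq _ v'k').
  have := step _ _ v'k' => s1; have := step _ _ s1 => s2.
  have := representsD (representsD s1 s1) (representsN s2).
  congr represents; apply/funext => x'; apply/funext => j'.
  rewrite (@tw_eq _ k') => [|u]; last by rewrite twi addr0.
  by rewrite /=; ring.
- move=> v'; have [k' v'k'] := represents_exists G v'.
  apply: (represents_eq _ v'k').
  have := step _ _ v'k' => s1.
  have := step _ _ (representsD (representsD v'k' v'k') (representsN s1)).
  congr represents; apply/funext => x'; apply/funext => j'.
  rewrite (@tw_eq _ k') => [|u]; last by rewrite twi addr0 addrK.
  by rewrite /=; ring.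
- apply: (@infinite_injective_range _ _ (fun d => iter d (H1_map Ft) v)); last first.
    by move=> d; exists (Posz d).
  apply: inj; elim=> [|d IH] /=.
    by move: vk; congr represents; apply/funext => x'; apply/funext => j';
      rewrite mul0r addr0.
  have := step _ _ IH; congr represents; apply/funext => x'; apply/funext => j'.
  rewrite (@tw_eq _ k) => [|u]; last by rewrite twi mulr0 addr0.
  by rewrite -natr1; ring.
Qed.
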